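(* Let $G \in \mathscr S$ be such that some open subgroup of $G$ admits a decomposition as a direct product of two non-trivial closed factors. Then $G$ is abstractly simple.
   Context: $\mathscr S$ denotes the class of compactly generated locally compact groups that are totally disconnected, topologically simple, and non-discrete. ''Abstractly simple'' means having no normal subgroups (closed or not) other than $\{e\}$ and $G$. *)

(* Defs.v *)
From HB Require Import structures.
From mathcomp Require Import all_boot all_classical.
From mathcomp Require Import topology.

Set Implicit Arguments.
Unset Strict Implicit.
Unset Printing Implicit Defensive.

Local Open Scope classical_set_scope.
Local Open Scope group_scope.

HB.mixin Record Topological_isTopologicalGroup G of Topological G & Group G := {
  mulg_continuous : continuous (fun x : G * G => x.1 * x.2);
  invg_continuous : continuous (fun x : G => x^-1)
}.

#[short(type="topologicalGroupType")]
HB.structure Definition TopologicalGroup :=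
  {G of Topological G & Group G & Topological_isTopologicalGroup G}.

Definition subgroup (G : groupType) (H : set G) : Prop := group_closed (mem H).

Definition normal_subgroup (G : groupType) (N : set G) : Prop :=
  subgroup N /\ forall x g : G, N x -> N (x ^ g).

Definition generated_subgroup (G : groupType) (K : set G) : set G :=
  smallest (@subgroup G) K.

(* No topological condition is imposed.  When G is a compactly generated locally
   compact group, U an open subgroup and A, B closed, all three are
   sigma-compact, so by the open mapping theorem the multiplication map
   A * B -> U is automatically a homeomorphism. *)
Definition direct_product (G : groupType) (U A B : set G) : Prop :=
  [/\ subgroup A, subgroup B,
      forall a b : G, A a -> B b -> commute a b,
      A `&` B = [set 1]
    & U = [set a * b | a in A & b in B]].

Definition abstractly_simple (G : groupType) : Prop :=
  forall N : set G, normal_subgroup N -> N = [set 1] \/ N = [set: G].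

Definition topologically_simple (G : topologicalGroupType) : Prop :=
  forall N : set G, normal_subgroup N -> closed N ->
    N = [set 1] \/ N = [set: G].

Definition compactly_generated (G : topologicalGroupType) : Prop :=
  exists2 K : set G, compact K & generated_subgroup K = [set: G].

Definition discrete_space (T : topologicalType) : Prop :=
  @nbhs T T = principal_filter.

(* Simplicity is stated without requiring the group to be nontrivial; in the
   class below nontriviality is a consequence of nondiscreteness.  Locally
   compact groups are Hausdorff by convention. *)
Record class_S (G : topologicalGroupType) : Prop := ClassS {
  class_S_hausdorff : hausdorff_space G;
  class_S_locally_compact : locally_compact [set: G];
  class_S_compactly_generated : compactly_generated G;
  class_S_totally_disconnected : totally_disconnected [set: G];
  class_S_topologically_simple : topologically_simple G;
  class_S_nondiscrete : ~ discrete_space G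
}.

(* Main.v *)
Require Import Defs.
From mathcomp Require Import all_boot all_classical.
From mathcomp Require Import topology.
Local Open Scope classical_set_scope.
Local Open Scope group_scope.

Set Implicit Arguments.
Unset Strict Implicit.
Unset Printing Implicit Defensive.

(** Call a subgroup P a local factor when P is its own bicentralizer and
    P C(P) is, locally at 1, a product neighbourhood.  The quasi-center of G is
    trivial, so the local factors form a Boolean algebra under intersection and
    centralizer, on which G acts by conjugation; the given decomposition makes
    it non-trivial.  Compact generation yields two finiteness properties:
    finitely many conjugates of any P <> 1 have trivial common centralizer, and
    there are finitely many non-trivial M_1, ..., M_r such that every P <> 1
    contains a conjugate of some M_i.  The latter, with the absence of atoms,
    gives g and M with g M g^-1 strictly inside M.

    Let N be a non-trivial normal subgroup.  It is dense, and perturbing g by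
    an element normalizing M we may take g in N.  Put
    E_k = g^k (M n C(g M g^-1)) g^-k.  A limit of elements of E_k, k -> oo,
    centralizes C(M), every E_k and every local factor inside all g^k M g^-k, so
    it normalizes all local factors and is trivial.  Hence g contracts a
    neighbourhood of 1 in some E_m.  An infinite product then writes every b in
    that neighbourhood as a commutator x g x^-1 g^-1, which is in N.  So N
    contains an open piece of a non-trivial local factor, and by the first
    finiteness property N is open, hence equal to G. *)

(** * Subgroups and topological groups *)

(* As [x ^ g] is [g^-1 * x * g], this is the set [g H g^-1]. *)
Definition conjset (G : groupType) (g : G) (H : set G) : set G :=
  [set x | H (x ^ g)].

Definition centralizer (G : groupType) (H : set G) : set G :=
  [set x | forall h, H h -> commute x h].

Section Subgroups.
Variable G : groupType.
Implicit Types (A B H K : set G) (x y g h : G).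

Lemma subgroupP H :
  subgroup H <-> H 1 /\ forall x y, H x -> H y -> H (x / y).
Proof.
split=> -[H1 HB]; split.
- by move: H1; rewrite inE.
- by move=> x y Hx Hy; have := HB x y; rewrite !inE; exact.
- by rewrite inE.
- by move=> x y; rewrite !inE; exact: HB.
Qed.

Lemma subgroup1 H : subgroup H -> H 1.
Proof. by case/subgroupP. Qed.

Lemma subgroupV H x : subgroup H -> H x -> H x^-1.
Proof. by case/subgroupP=> H1 HB Hx; rewrite -[x^-1]mul1g; exact: HB. Qed.

Lemma subgroupM H x y : subgroup H -> H x -> H y -> H (x * y).
Proof.
move=> sH Hx Hy; rewrite -[y]invgK; have [_] := (subgroupP H).1 sH.
by apply=> //; exact: subgroupV.
Qed.

Lemma subgroupJ H x y : subgroup H -> H x -> H y -> H (x ^ y).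
Proof.
move=> sH Hx Hy; rewrite conjgE; apply: subgroupM => //; first exact: subgroupV.
exact: subgroupM.
Qed.

Lemma subgroupI H K : subgroup H -> subgroup K -> subgroup (H `&` K).
Proof.
move=> /subgroupP[H1 HB] /subgroupP[K1 KB]; apply/subgroupP; split=> //.
by move=> x y [Hx Kx] [Hy Ky]; split; [exact: HB|exact: KB].
Qed.

Lemma subgroup_conjset H g : subgroup H -> subgroup (conjset g H).
Proof.
move=> /subgroupP[H1 HB]; apply/subgroupP; rewrite /conjset /= conj1g; split=> //.
by move=> x y /= Hx Hy; rewrite conjMg conjVg; exact: HB.
Qed.

Lemma conjsetM g h H : conjset (g * h) H = conjset g (conjset h H).
Proof. by apply/seteqP; split=> x; rewrite /conjset /= conjgM. Qed.

Lemma conjset1 H : conjset 1 H = H.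
Proof. by apply/seteqP; split=> x; rewrite /conjset /= conjg1. Qed.

Lemma conjsetK g H : conjset g^-1 (conjset g H) = H.
Proof. by rewrite -conjsetM mulVg conjset1. Qed.

Lemma conjsetVK g H : conjset g (conjset g^-1 H) = H.
Proof. by rewrite -conjsetM mulgV conjset1. Qed.

Lemma conjsetS g A B : A `<=` B -> conjset g A `<=` conjset g B.
Proof. by move=> AB x; exact: AB. Qed.

Lemma conjsetI g A B : conjset g (A `&` B) = conjset g A `&` conjset g B.
Proof. by []. Qed.

Lemma conjset_sub1 g : conjset g [set 1] = [set 1] :> set G.
Proof.
apply/seteqP; split=> x; rewrite /conjset /=; last by move=> ->; rewrite conj1g.
by move/eqP; rewrite conjg_eq1 => /eqP.
Qed.

Lemma commuteJ x y g : commute x y -> commute (x ^ g) (y ^ g).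
Proof. by rewrite /commute -!conjMg => ->. Qed.

Lemma conjg_commute x y : commute x y -> x ^ y = x.
Proof. by move=> xy; rewrite conjgE xy mulKg. Qed.

Lemma subgroup_centralizer H : subgroup (centralizer H).
Proof.
apply/subgroupP; split=> [h _|x y Hx Hy h Hh]; first exact/commute_sym/commute1.
apply/commute_sym/commuteM; first exact/commute_sym/Hx.
exact/commuteV/commute_sym/Hy.
Qed.

Lemma centralizerS A B : A `<=` B -> centralizer B `<=` centralizer A.
Proof. by move=> AB x Bx h /AB /Bx. Qed.

Lemma sub_centralizerC A B : A `<=` centralizer B -> B `<=` centralizer A.
Proof. by move=> AB b Bb a Aa; apply/commute_sym/AB. Qed.

Lemma sub_centralizer2 A : A `<=` centralizer (centralizer A).
Proof. exact: sub_centralizerC. Qed.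

Lemma centralizer3 A : centralizer (centralizer (centralizer A)) = centralizer A.
Proof.
by apply/seteqP; split; [exact/centralizerS/sub_centralizer2|exact: sub_centralizer2].
Qed.

Lemma centralizer_conjset g A : centralizer (conjset g A) = conjset g (centralizer A).
Proof.
apply/seteqP; split=> x Hx a Aa.
  rewrite -(conjgKV g a) /=; apply/commuteJ/Hx.
  by rewrite /conjset /= conjgKV.
by rewrite -(conjgK g x) -(conjgK g a); apply/commuteJ/Hx.
Qed.

Lemma centralizerU A B : centralizer (A `|` B) = centralizer A `&` centralizer B.
Proof.
apply/seteqP; split=> [x Hx|x [HA HB] h [/HA|/HB]//].
by split=> h Ah; apply: Hx; [left|right].
Qed.

Lemma centralizer1 : centralizer [set 1] = [set: G].
Proof. by apply/seteqP; split=> // x _ _ ->; exact: commute1. Qed.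

Lemma normal_subgroup_conjset N : normal_subgroup N -> forall g, conjset g N = N.
Proof.
move=> [_ nN] g; apply/seteqP; split=> x; last exact: nN.
by move/(nN _ g^-1); rewrite conjgK.
Qed.

End Subgroups.

(** * Continuity, neighbourhoods of 1 and closures in a topological group *)

Section TopGroup.
Variable G : topologicalGroupType.
Implicit Types (A B D H K N O V : set G) (x y g h : G).

Lemma preimage_nbhs (S T : topologicalType) (f : S -> T) (s : S) (O : set T) :
  continuous f -> nbhs (f s) O -> nbhs s (f @^-1` O).
Proof. by move=> cf; exact: cf. Qed.

Lemma continuousM (T : topologicalType) (f g : T -> G) :
  continuous f -> continuous g -> continuous (fun t => f t * g t).
Proof.
move=> cf cg x.
apply: (@continuous_comp T (G * G)%type G (fun t => (f t, g t))
  (fun p : G * G => p.1 * p.2)); last exact: mulg_continuous.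
by apply: cvg_pair; [exact: cf|exact: cg].
Qed.

Lemma continuousV (T : topologicalType) (f : T -> G) :
  continuous f -> continuous (fun t => (f t)^-1).
Proof.
move=> cf x; apply: (@continuous_comp T G G f (fun x => x^-1)); first exact: cf.
exact: invg_continuous.
Qed.

Lemma idg_continuous : continuous (fun x : G => x).
Proof. by move=> x; exact: cvg_id. Qed.

Lemma mulgl_continuous g : continuous (fun x => g * x).
Proof. by apply: continuousM; [exact: cst_continuous|exact: idg_continuous]. Qed.

Lemma mulgr_continuous g : continuous (fun x => x * g).
Proof. by apply: continuousM; [exact: idg_continuous|exact: cst_continuous]. Qed.

Lemma conjg_continuous g : continuous (fun x => x ^ g).
Proof.
apply: continuousM; first exact: cst_continuous.
exact: mulgr_continuous.
Qed.

Lemma open_mulgl g O : open O -> open [set x | O (g * x)].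
Proof. by move/(continuousP _).1: (mulgl_continuous (g:=g)); exact. Qed.

Lemma closed_conjset g H : closed H -> closed (conjset g H).
Proof. by move/continuous_closedP: (conjg_continuous (g:=g)); exact. Qed.

Lemma nbhs1T : nbhs (1 : G) [set: G].
Proof. exact: filterT. Qed.

Lemma nbhs1_conjset g O : nbhs 1 O -> nbhs 1 (conjset g O).
Proof.
by move=> O1; apply: (preimage_nbhs (@conjg_continuous g)); rewrite conj1g.
Qed.

Lemma nbhs1_mul O : nbhs (1 : G) O ->
  exists2 O', nbhs 1 O' & forall x y, O' x -> O' y -> O (x * y).
Proof.
move=> O1; have := @preimage_nbhs _ _ _ (1, 1) O (@mulg_continuous G).
rewrite /= mulg1 => /(_ O1)[[X Y] /= [X1 Y1] XY].
exists (X `&` Y); first exact: filterI.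
by move=> x y [Xx _] [_ Yy]; apply: (XY (x, y)).
Qed.

Lemma nbhs_mulgl x O : nbhs 1 [set y | O (x * y)] -> nbhs x O.
Proof.
move=> H; have := @preimage_nbhs _ _ _ x _ (@mulgl_continuous x^-1).
rewrite mulVg => /(_ _ H); by apply: filterS => y /=; rewrite mulVKg.
Qed.

Lemma nbhs1_mulgl x O : nbhs x O -> nbhs 1 [set y | O (x * y)].
Proof.
by move=> H; apply: (preimage_nbhs (@mulgl_continuous x)); rewrite mulg1.
Qed.

Lemma subgroup_open H : subgroup H -> nbhs 1 H -> open H.
Proof.
move=> sH H1; rewrite openE => x Hx; apply: nbhs_mulgl.
by apply: filterS H1 => y; exact: subgroupM.
Qed.

Lemma subgroup_open_closed H : subgroup H -> open H -> closed H.
Proof.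
move=> sH oH x Hx.
have H1 : nbhs 1 H by apply: open_nbhs_nbhs; split=> //; exact: subgroup1.
have /Hx[y [Hy]] : nbhs x [set y | H (x^-1 * y)].
  by apply: nbhs_mulgl; apply: filterS H1 => y /=; rewrite mulKg.
move=> /(subgroupV sH); rewrite /= invgM invgK => /(subgroupM sH Hy).
by rewrite mulVKg.
Qed.

Lemma normal_closure N : normal_subgroup N -> normal_subgroup (closure N).
Proof.
move=> [sN nN]; split; last first.
  move=> x g Nx O Og.
  have /Nx[y [Ny /= Oy]] := preimage_nbhs (@conjg_continuous g) Og.
  by exists (y ^ g); split=> //; exact: nN.
apply/subgroupP; split; first by apply: subset_closure; exact: subgroup1.
move=> x y Nx Ny O Oxy.
have c : continuous (fun p : G * G => p.1 / p.2).
  apply: continuousM; first by move=> p; exact: cvg_fst.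
  by apply: continuousV; move=> p; exact: cvg_snd.
have [[X Y] /= [/Nx[x' [Nx' Xx]] /Ny[y' [Ny' Yy]]] XY] := c (x, y) _ Oxy.
exists (x' / y'); split; first by apply: subgroupM => //; exact: subgroupV.
by apply: (XY (x', y')).
Qed.

Lemma dense_coset D O x : closure D = [set: G] -> nbhs 1 O ->
  exists2 d, D d & O (x^-1 * d).
Proof.
move=> Dd O1; have : closure D x by rewrite Dd.
have Ox : nbhs x [set y | O (x^-1 * y)].
  by apply: nbhs_mulgl; apply: filterS O1 => y /=; rewrite mulKg.
by move=> /(_ _ Ox)[d [? ?]]; exists d.
Qed.

Hypothesis T2 : hausdorff_space G.

Lemma closed_sub1 : closed ([set 1] : set G).
Proof. exact: accessible_closed_set1 (hausdorff_accessible T2) _. Qed.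

Lemma closed_centralizer H : closed (centralizer H).
Proof.
have -> : centralizer H = \bigcap_(h in H) [set x | [set 1] (x * h * (x^-1 * h^-1))].
  apply/seteqP; split=> x Hx h Hh /=; first by rewrite (Hx h Hh) !mulgA mulgK mulgV.
  have /= := Hx h Hh; rewrite -(invgK (x^-1 * h^-1)) => /divg1_eq.
  by rewrite invgM !invgK.
apply: closed_bigI => h _.
apply: (preimage_closed (f := fun x => x * h * (x^-1 * h^-1)));
  last exact: closed_sub1.
move=> y _; move: y.
apply: continuousM; first exact: mulgr_continuous.
apply: continuousM; last exact: cst_continuous.
exact/continuousV/idg_continuous.
Qed.

End TopGroup.

(** * Local factors *)

(** This says that multiplication from A x B to G is open at 1. Restricting both factors to [O] lets
    small elements have small components. *)
Definition local_product (G : topologicalGroupType) (A B : set G) : Prop :=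
  forall O : set G, nbhs 1 O ->
    nbhs 1 [set a * b | a in A `&` O & b in B `&` O].

Definition local_factor (G : topologicalGroupType) (P : set G) : Prop :=
  centralizer (centralizer P) = P /\ local_product P (centralizer P).

Definition quasi_center (G : topologicalGroupType) : set G :=
  [set x | nbhs 1 (centralizer [set x])].

Section LocalFactors.
Variable G : topologicalGroupType.
Implicit Types (A B D H K N O P Q R V : set G) (x y g h : G).

Lemma local_productC A B :
  A `<=` centralizer B -> local_product A B -> local_product B A.
Proof.
move=> AB AxB O /AxB; apply: filterS => _ [a [Aa Oa] [b [Bb Ob]] <-].
by exists b => //; exists a => //; apply/esym/AB.
Qed.

Lemma local_productS A B A' B' : A `<=` A' -> B `<=` B' ->
  local_product A B -> local_product A' B'.
Proof.
move=> AA BB AxB O /AxB; apply: filterS => _ [a [Aa Oa] [b [Bb Ob]] <-].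
by exists a; [split=> //; exact: AA|exists b => //; split=> //; exact: BB].
Qed.

Lemma local_product_conjset g A B :
  local_product A B -> local_product (conjset g A) (conjset g B).
Proof.
move=> AxB O /(nbhs1_conjset g^-1)/AxB/(nbhs1_conjset g).
apply: filterS => x [a [Aa Oa] [b [Bb Ob] abx]].
exists (a ^ g^-1); first by split=> //; rewrite /conjset /= conjgKV.
exists (b ^ g^-1); first by split=> //; rewrite /conjset /= conjgKV.
by rewrite -conjMg abx conjgK.
Qed.

Hypothesis qz : @quasi_center G = [set 1].

Lemma qz_eq1 x O : nbhs 1 O -> (forall y, O y -> commute x y) -> x = 1.
Proof.
move=> O1 Ox; suff : quasi_center x by rewrite qz.
by apply: filterS O1 => y Oy _ ->; apply/commute_sym/Ox.
Qed.

Lemma local_product_center A B x :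
  local_product A B -> centralizer A x -> centralizer B x -> x = 1.
Proof.
move=> /(_ setT (nbhs1T G)) AxB Ax Bx; apply: (qz_eq1 AxB).
by move=> _ [a [Aa _] [b [Bb _]] <-]; apply: commuteM; [exact: Ax|exact: Bx].
Qed.

Lemma local_product_disjoint A B x :
  A `<=` centralizer B -> local_product A B -> A x -> B x -> x = 1.
Proof.
move=> AB AxB Ax Bx; apply: (local_product_center AxB).
  exact: (sub_centralizerC AB).
exact: AB.
Qed.

Lemma local_productI A B O :
  local_product A B -> nbhs 1 O -> local_product (A `&` O) (B `&` O).
Proof.
move=> AxB O1 U U1; have OU1 : nbhs 1 (O `&` U) by exact: filterI.
apply: filterS (AxB _ OU1) => _ [a [Aa [Oa Ua]] [b [Bb [Ob Ub]]] <-].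
by exists a => //; exists b.
Qed.

(* The commutator of [a] and [x] below centralises small elements of both
   factors, so it is quasi-central. *)
Lemma centralizer_setI_nbhs A B O : subgroup A -> A `<=` centralizer B ->
  local_product A B -> nbhs 1 O -> centralizer (A `&` O) = centralizer A.
Proof.
move=> sA AB AxB O1; apply/seteqP; split; last by apply: centralizerS; exact: subIsetl.
move=> x Cx a Aa; pose c := a^-1 * a ^ x^-1.
have conjc y : y ^ c = (((y ^ a^-1) ^ x) ^ a) ^ x^-1.
  by rewrite -!conjgM /c [a ^ _]conjgE invgK !mulgA.
have commute_c y : y ^ c = y -> commute c y.
  by move=> yc; apply/esym; rewrite conjgC yc.
suff c1 : c = 1.
  have : a ^ x^-1 = a by rewrite -[LHS](mulVKg a) -/c c1 mulg1.
  by rewrite conjgE invgK mulgA => /(congr1 (fun z => z * x)); rewrite mulgVK.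
pose W := [set a * b | a in A `&` O & b in B `&` O].
(* For [y] in [O'], both [y] and [y ^ a^-1] lie in [O], and [y ^ x] splits along [W]. This is what
   is needed to follow [y] through the four conjugations of [conjc]. *)
pose O' := (O `&` conjset a^-1 O) `&` conjset x W.
have O'1 : nbhs 1 O'.
  apply: filterI; first by apply: filterI => //; exact: nbhs1_conjset.
  by apply: nbhs1_conjset; exact: AxB.
have AxBO' := local_productI AxB O'1.
have Cx' k : (A `&` O) k -> k ^ x = k.
  by move=> /Cx/commute_sym/conjg_commute.
apply: (local_product_center AxBO').
  move=> k [Ak [[Ok Oak] _]]; apply: commute_c; rewrite conjc Cx'; last first.
    by split=> //; apply: subgroupJ => //; exact: subgroupV.
  by rewrite conjgKV -{1}(Cx' k)// conjgK.
move=> b [Bb [_ [p [Ap Op] [q [Bq Oq] pq]]]].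
apply: commute_c; rewrite conjc.
have bV : b ^ a^-1 = b.
  by apply/conjg_commute/commuteV/commute_sym/AB.
suff Bbx : B (b ^ x).
  by rewrite bV (conjg_commute (commute_sym (AB _ Aa _ Bbx))) conjgK.
(* The [A]-component of [b ^ x] centralizes small elements of [A], since [b ^ x] and [q] do, and
   also those of [B]; hence it is 1. *)
suff p1 : p = 1 by rewrite -pq p1 mul1g.
apply: (local_product_center (local_productI AxB O1)); last first.
  by move=> k [Bk _]; exact: AB.
have -> : p = b ^ x / q by rewrite -pq mulgK.
move=> k [Ak Ok]; apply/commute_sym/commuteM; last first.
  by apply/commuteV/AB.
rewrite -(Cx' k)//; apply: commuteJ; exact: AB.
Qed.

Lemma local_factor_subgroup P : local_factor P -> subgroup P.
Proof. by case=> <- _; exact: subgroup_centralizer. Qed.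

Lemma local_factorC P : local_factor P -> local_factor (centralizer P).
Proof.
case=> PCC PxQ; split; first exact: centralizer3.
by rewrite PCC; apply: local_productC => //; exact: sub_centralizer2.
Qed.

Lemma local_factor_conjset g P : local_factor P -> local_factor (conjset g P).
Proof.
case=> PCC PxQ; split; first by rewrite !centralizer_conjset PCC.
by rewrite centralizer_conjset; exact: local_product_conjset.
Qed.

Lemma local_factor_centralizer_setI P O :
  local_factor P -> nbhs 1 O -> centralizer (P `&` O) = centralizer P.
Proof.
move=> fP; apply: (@centralizer_setI_nbhs P (centralizer P)); last by case: fP.
  exact: local_factor_subgroup.
exact: sub_centralizer2.
Qed.

Lemma local_factor_disjoint P x : local_factor P -> P x -> centralizer P x -> x = 1.
Proof.
by case=> _ PxQ; apply: (local_product_disjoint _ PxQ); exact: sub_centralizer2.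
Qed.

Lemma local_factor_setT : local_factor [set: G].
Proof.
have CT : centralizer [set: G] = [set 1].
  apply/seteqP; split=> [x Cx|_ -> h _]; last exact/commute_sym/commute1.
  by apply: (@qz_eq1 _ setT); [exact: filterT|move=> y _; exact: Cx].
split; first by rewrite CT centralizer1.
rewrite CT => O O1; apply: filterS (O1) => x Ox; exists x => //; exists 1.
  by split=> //; exact: nbhs_singleton.
by rewrite mulg1.
Qed.

(** A small [s] in C(R) fixes [r] and, being in P C(P), preserves both P and C(P); so it fixes the
    components of [r]. Hence [p] commutes with small elements of C(R), and so lies in CC(R) = R. *)
Lemma local_factor_split P R O : local_factor P -> local_factor R ->
  nbhs 1 O -> exists2 O', nbhs 1 O' & forall r, R r -> O' r ->
    exists p q, [/\ R p, P p & O p] /\ [/\ R q, centralizer P q & O q] /\ r = p * q.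
Proof.
move=> fP fR O1; have [PCC PxQ] := fP.
pose W U := [set a * b | a in P `&` U & b in centralizer P `&` U].
exists (W O); first exact: PxQ.
move=> r Rr [p [Pp Op] [q [Qq Oq] pqr]].
have Rp : R p.
  case: (fR) => <- _.
  have PQ1 := PxQ _ (nbhs1T G).
  rewrite -(local_factor_centralizer_setI (local_factorC fR) PQ1).
  move=> s [Cs [a [Pa _] [b [Qb _] abs]]].
  have Ps t : P t -> P (t ^ s).
    move=> Pt; rewrite -abs conjgM (conjg_commute (y := b)).
      by apply: subgroupJ => //; exact: local_factor_subgroup.
    by apply/commute_sym/Qb; apply: subgroupJ => //; exact: local_factor_subgroup.
  have Qs t : centralizer P t -> centralizer P (t ^ s).
    move=> Qt; rewrite -abs conjgM (conjg_commute (x := t)) //; last exact: Qt.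
    exact: (subgroupJ (@subgroup_centralizer _ P)).
  have rs : r ^ s = r by apply/conjg_commute/commute_sym/Cs.
  have : p^-1 * p ^ s = 1.
    apply: (local_factor_disjoint fP).
      apply: subgroupM; [exact: local_factor_subgroup| |exact: Ps].
      by apply: subgroupV => //; exact: local_factor_subgroup.
    have -> : p^-1 * p ^ s = q * (q ^ s)^-1.
      apply: (mulgI p); apply: (mulIg (q ^ s)).
      by rewrite mulVKg -conjMg pqr rs -mulgA mulgVK pqr.
    apply: (subgroupM (@subgroup_centralizer _ P)) => //.
    by apply: (subgroupV (@subgroup_centralizer _ P)); exact: Qs.
  move/mulg1_eq; rewrite invgK => ps.
  by rewrite /commute [LHS]conjgC -ps.
exists p, q; do 2![split=> //]; split=> //.
have -> : q = p^-1 * r by rewrite -pqr mulKg.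
apply: subgroupM => //; first exact: local_factor_subgroup.
by apply: subgroupV => //; exact: local_factor_subgroup.
Qed.

(** An intersection of centralizers is the centralizer of a union. For the local product, write a
    small element as [p * q] along [P], then split [p] along [R] as [a * b]: [a] lies in both
    factors and [b * q] centralizes their intersection. *)
Lemma local_factorI P R :
  local_factor P -> local_factor R -> local_factor (P `&` R).
Proof.
move=> fP fR; split.
  by case: fP => <- _; case: fR => <- _; rewrite -centralizerU centralizer3.
move=> O /nbhs1_mul[O1 O11 O1M].
have [O2 O21 splitP] := local_factor_split fR fP O11.
have O1O2 : nbhs 1 (O1 `&` O2) by exact: filterI.
have [_ PxQ] := fP; apply: filterS (PxQ _ O1O2).
move=> _ [p [Pp [O1p O2p]] [q [Qq [O1q O2q]]] <-].
have [a [b [[Pa Ra Oa] [[Pb Rb Ob] ->]]]] := splitP _ Pp O2p.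
exists a.
  by split=> //; rewrite -(mulg1 a); apply: O1M => //; exact: (nbhs_singleton O11).
exists (b * q); last by rewrite mulgA.
split; last exact: O1M.
apply: (subgroupM (@subgroup_centralizer _ (P `&` R))).
  by apply: centralizerS Rb; exact: subIsetr.
by apply: centralizerS Qq; exact: subIsetl.
Qed.

(** If only 1 were in both [P] and [O], then C(P) would be all of [G], whereas [P] meets C(P)
    trivially. *)
Lemma local_factor_nontrivial P O :
  local_factor P -> nbhs 1 O -> P <> [set 1] ->
  exists p, [/\ P p, O p & p <> 1].
Proof.
move=> fP O1 P1; apply: contrapT => H; apply: P1.
have PO : P `&` O = [set 1].
  apply/seteqP; split=> [p [Pp Op]|_ ->].
    by apply: contrapT => p1; apply: H; exists p.
  by split; [exact: subgroup1 (local_factor_subgroup fP)|exact: nbhs_singleton].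
have := local_factor_centralizer_setI fP O1; rewrite PO centralizer1 => CP.
apply/seteqP; split=> [p Pp|_ ->].
  by apply: (local_factor_disjoint fP) => //; rewrite -CP.
exact: subgroup1 (local_factor_subgroup fP).
Qed.

(** Disjoint elements of the Boolean algebra commute: a small element of [P], split along [R], has
    its first component in both factors, so it equals its component in C(R). *)
Lemma local_factor_sub_centralizer P R : local_factor P -> local_factor R ->
  P `&` R `<=` [set 1] -> P `<=` centralizer R.
Proof.
move=> fP fR PR; apply: sub_centralizerC.
have [O O1 split] := local_factor_split fR fP (nbhs1T G).
rewrite -(local_factor_centralizer_setI fP O1); apply: sub_centralizerC.
move=> p [Pp Op]; have [a [b [[Pa Ra _] [[_ Cb _] ->]]]] := split _ Pp Op.
by rewrite [a]PR // mul1g.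
Qed.

Lemma local_factor_sub P R : local_factor P -> local_factor R ->
  P `&` centralizer R `<=` [set 1] -> P `<=` R.
Proof.
move=> fP fR /(local_factor_sub_centralizer fP (local_factorC fR)).
by case: fR => ->.
Qed.

End LocalFactors.

(** * Compact open subgroups *)

Section Compactness.
Variable G : topologicalGroupType.
Implicit Types (A B C D H K N O P Q R U V W : set G) (x y g h : G).

Lemma compact_seq_cover (T : topologicalType) (I : choiceType) (K : set T)
    (D : set I) (f : I -> set T) :
  compact K -> (forall i, D i -> open (f i)) ->
  (forall p, K p -> exists2 i, D i & f i p) ->
  exists2 s : seq I, forall i, i \in s -> D i &
    forall p, K p -> exists2 i, i \in s & f i p.
Proof.
move=> /compact_near_coveringP cK fo Kf.
pose inD (s : seq I) := forall i, i \in s -> D i.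
(* Finite index sequences directed by inclusion: along this filter, being covered holds near each
   point, hence uniformly on [K]. *)
pose F := filter_from inD (fun s => [set s' | inD s' /\ {subset s <= s'}]).
have FF : Filter F.
  apply: filter_from_filter; first by exists [::].
  move=> s t Ds Dt; exists (s ++ t).
    by move=> i; rewrite mem_cat => /orP[/Ds|/Dt].
  move=> u [Du stu]; split; split=> // i ?; apply: stu.
    by rewrite mem_cat; apply/orP; left.
  by rewrite mem_cat; apply/orP; right.
have [|s Ds Ks] := cK _ F (fun s p => exists2 i, i \in s & f i p) FF.
- move=> p /Kf[i Di fip].
  exists (f i, [set s | inD s /\ {subset [:: i] <= s}]).
    split=> /=; first by apply: open_nbhs_nbhs; split=> //; exact: fo.
    by exists [:: i] => // j; rewrite inE => /eqP->.
  by move=> [q s] /= [fiq [_ is_]]; exists i => //; apply: is_; rewrite inE.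
- by have {}Ks := Ks s (conj Ds (fun _ => id)); exists s.
Qed.

Lemma compact_cosets K W : compact K -> nbhs 1 W -> subgroup W ->
  exists2 s : seq G, forall t, t \in s -> K t &
    forall x, K x -> exists2 t, t \in s & W (t^-1 * x).
Proof.
move=> cK W1 sW; apply: (compact_seq_cover cK) => [t _|x Kx].
  exact/open_mulgl/subgroup_open.
by exists x => //; rewrite /= mulVg; exact: subgroup1.
Qed.

(** The conjugate of [W] by [k] depends only on the coset kW, and finitely many cosets cover [K]. *)
Lemma subgroup_core_nbhs K W : compact K -> nbhs 1 W -> subgroup W ->
  nbhs 1 (\bigcap_(k in K) conjset k W).
Proof.
move=> cK W1 sW; have [s sK Ks] := compact_cosets cK W1 sW.
have : nbhs 1 [set x | forall t, t \in s -> conjset t W x].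
  elim: s {sK Ks} => [|t s IHs]; first by apply: filterS (nbhs1T G).
  apply: filterS (filterI (nbhs1_conjset t W1) IHs) => x [Wx sWx] u.
  by rewrite inE => /orP[/eqP->|/sWx].
apply: filterS => x Hx k /Ks[t /Hx tx Wtk].
rewrite /conjset /= in tx *.
by rewrite -(mulVKg t k) conjgM; exact: subgroupJ.
Qed.

Hypothesis T2 : hausdorff_space G.

Lemma compact_mul A B : compact A -> compact B ->
  compact [set a * b | a in A & b in B].
Proof.
move=> cA cB.
have -> : [set a * b | a in A & b in B] =
    (fun p : G * G => p.1 * p.2) @` (A `*` B).
  apply/seteqP; split=> [_ [a Aa [b Bb <-]]|_ [[a b] [/= Aa Bb] <-]].
    by exists (a, b).
  by exists a => //; exists b.
apply: continuous_compact; last exact: compact_setX.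
exact/continuous_subspaceT/mulg_continuous.
Qed.

Lemma compact_inv A : compact A -> compact [set x | A x^-1].
Proof.
move=> cA; have -> : [set x | A x^-1] = (fun x => x^-1) @` A.
  apply/seteqP; split=> [x Ax|_ [x Ax <-]]; last by rewrite /= invgK.
  by exists x^-1 => //; rewrite invgK.
by apply: continuous_compact => //; exact/continuous_subspaceT/invg_continuous.
Qed.

(** The set A^-1 B is compact, hence closed, and misses 1. If it also misses O O, the translates of
    A and B by a symmetric neighbourhood inside O are disjoint. *)
Lemma compact_separate A B : compact A -> compact B -> A `&` B = set0 ->
  exists U V, [/\ open U, open V, A `<=` U, B `<=` V & U `&` V = set0].
Proof.
move=> cA cB AB0.
have /closed_openC oW : closed [set x * b | x in [set x | A x^-1] & b in B].
  by apply: compact_closed => //; apply: compact_mul => //; exact: compact_inv.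
have /nbhs1_mul[O] : nbhs 1 (~` [set x * b | x in [set x | A x^-1] & b in B]).
  apply: open_nbhs_nbhs; split; first exact: oW.
  move=> -[x Ax [b Bb /mulg1_eq xb]].
  suff : (A `&` B) b by rewrite AB0.
  by split=> //; rewrite -xb.
move=> O1 OO.
pose tr S := [set x | exists2 s, S s & (O `&` [set x | O x^-1])° (s^-1 * x)].
have otr S : open (tr S).
  have -> : tr S = \bigcup_(s in S) [set x | (O `&` [set x | O x^-1])° (s^-1 * x)].
    by apply/seteqP; split=> x [s]; exists s.
  by apply: bigcup_open => s _; apply: open_mulgl; exact: open_interior.
have str S : S `<=` tr S.
  move=> s Ss; exists s => //; rewrite mulVg; apply: filterI => //.
  apply: (preimage_nbhs (@invg_continuous G)); by rewrite invg1.
exists (tr A), (tr B); split=> //.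
apply/seteqP; split=> // x [[a Aa /interior_subset[Oax _]]].
move=> [b Bb /interior_subset[_ Obx]].
apply: (OO _ _ Oax Obx); exists a^-1; first by rewrite /= invgK.
by exists b => //; rewrite invgM invgK !mulgA mulgK.
Qed.

(* The intersection of the relatively clopen subsets of [K] containing [x] is
   connected, hence reduced to [x]. *)
Lemma compact_open_nbhs K O x : totally_disconnected [set: G] ->
  compact K -> nbhs x K -> nbhs x O ->
  exists C, [/\ open C, compact C, C x & C `<=` O].
Proof.
move=> td cK Kx Ox.
have clK : closed K by exact: compact_closed.
pose F : set (set G) := [set D | [/\ closed D, D `<=` K, D x & closed (K `\` D)]].
pose Q := \bigcap_(D in F) D.
have FK : F K.
  split=> //; first exact: nbhs_singleton.
  by rewrite setDv; exact: closed0.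
have FI D E : F D -> F E -> F (D `&` E).
  move=> [cD DK Dx cKD] [cE EK Ex cKE]; split=> //.
  - exact: closedI.
  - by move=> y [/DK].
  - by rewrite setDIr; exact: closedU.
have QK : Q `<=` K by move=> y /(_ _ FK).
have Qx : Q x by move=> D [].
have cQ : closed Q by apply: closed_bigI => D [].
(* [F] is stable under intersection. If no member were inside [W], the differences of the members
   with [W] would cluster at a point of [Q] outside [W]. *)
have FW W : open W -> Q `<=` W -> exists2 D, F D & D `<=` W.
  move=> oW QW; apply: contrapT => noD.
  have FD0 D : F D -> exists2 y, D y & ~ W y.
    move=> FD; apply: contrapT => H; apply: noD; exists D => // y Dy.
    by apply: contrapT => Wy; apply: H; exists y.
  pose FF := filter_from F (fun D => D `\` W).
  have pFF : ProperFilter FF.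
    apply: filter_from_proper; last by move=> D /FD0[y Dy Wy]; exists y.
    apply: filter_from_filter; first by exists K.
    move=> D E FD FE; exists (D `&` E); first exact: FI.
    by move=> y [[Dy Ey] Wy].
  have [|y [Ky cy]] := cK FF pFF; first by exists K => // y [].
  have yD D : F D -> (D `\` W) y.
    move=> FD; have cDW : closed (D `\` W).
      by apply: closedI; [case: FD|exact: open_closedC].
    by apply: cDW => U Uy; apply: cy Uy; exists D.
  by have [_] := yD _ FK; apply; apply: QW => D /yD[].
have conQ : connected Q.
  move=> E [e Ee] [C1 oC1 E1] [C2 clC2 E2].
  pose E' := Q `&` ~` C1.
  have cptE : compact E.
    apply: subclosed_compact cK _; last by move=> y; rewrite E1 => -[/QK].
    by rewrite E2; exact: closedI.
  have cptE' : compact E'.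
    apply: subclosed_compact cK _; last by move=> y [/QK].
    by apply: closedI => //; exact: open_closedC.
  have EE' : E `&` E' = set0.
    by apply/seteqP; split=> // y []; rewrite E1 => -[_ ?] [].
  have [U [U' [oU oU' EU EU' UU']]] := compact_separate cptE cptE' EE'.
  have QUU : Q `<=` U `|` U'.
    move=> y Qy; have [C1y|C1y] := pselect (C1 y); last by right; exact: EU'.
    by left; apply: EU; rewrite E1.
  have [D FD DUU] := FW _ (openU oU oU') QUU.
  (* Cutting [D] by two disjoint open sets keeps the pieces relatively clopen, so the piece
     containing [x] is in [F] and [Q] lies entirely on that side. *)
  have FDU Z Z' : open Z -> open Z' -> Z `&` Z' = set0 -> D `<=` Z `|` Z' ->
      Z x -> F (D `&` Z).
    move=> oZ oZ' ZZ0 DZZ Zx; case: FD => cD DK Dx cKD.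
    have DZE : D `&` Z = D `&` ~` Z'.
      apply/seteqP; split=> y [Dy yZ]; split=> //.
        by move=> yZ'; suff : (Z `&` Z') y by rewrite ZZ0.
      by case: (DZZ _ Dy).
    split=> //.
    - by rewrite DZE; apply: closedI => //; exact: open_closedC.
    - by move=> y [/DK].
    - rewrite setDIr; apply: closedU => //.
      by apply: closedI => //; exact: open_closedC.
  have [xU|xU'] := QUU _ Qx.
    have FDU' := FDU _ _ oU oU' UU' DUU xU.
    rewrite E1; apply/seteqP; split=> [y []//|y Qy]; split=> //.
    apply: contrapT => C1y; suff : (U `&` U') y by rewrite UU'.
    by split; [have [] := Qy _ FDU'|exact: EU'].
  rewrite setUC in DUU; rewrite setIC in UU'.
  have FDU' := FDU _ _ oU' oU UU' DUU xU'.
  suff : (U' `&` U) e by rewrite UU'.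
  split; last exact: EU.
  have Qe : Q e by move: Ee; rewrite E1 => -[].
  by have [] := Qe _ FDU'.
have Q1 : Q = [set x].
  apply/seteqP; split=> [y Qy|_ ->//].
  have <- := td x Logic.I; exists Q => //.
have oKO : open (K° `&` O°) by apply: openI; exact: open_interior.
have QKO : Q `<=` K° `&` O° by rewrite Q1 => _ ->; split.
have [D [cD DK Dx cKD] DKO] := FW _ oKO QKO.
exists D; split=> //; last by move=> y /DKO[_ /interior_subset].
- have -> : D = K° `&` ~` (K `\` D).
    apply/seteqP; split=> [y Dy|y [/interior_subset Ky nKD]].
      by split; [case: (DKO _ Dy)|move=> [_]; apply].
    by apply: contrapT => Dy; apply: nKD.
  by apply: openI; [exact: open_interior|exact: closed_openC].
- exact: subclosed_compact cK _.
Qed.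

(** Van Dantzig's theorem. The right stabilizer of a compact open set [C] containing 1 is a subgroup
    inside [C]; compactness of [C] makes it a neighbourhood of 1. *)
Lemma compact_open_subgroup O : locally_compact [set: G] ->
  totally_disconnected [set: G] -> nbhs 1 O ->
  exists V, [/\ subgroup V, open V, compact V & V `<=` O].
Proof.
move=> lc td O1; have [K K1 [cK _]] := lc 1 Logic.I.
have {}K1 : nbhs 1 K.
  by move: K1; rewrite /within /prop_near1 /=; apply: filterS => x; apply.
have [C [oC cC C1 CO]] := compact_open_nbhs td cK K1 O1.
pose H := [set h | forall c, C c -> C (c * h) /\ C (c / h)].
have sH : subgroup H.
  apply/subgroupP; split=> [c Cc|x y Hx Hy c Cc].
    by rewrite invg1 mulg1.
  rewrite invgM invgK !mulgA; split.
    by apply Hy; apply Hx.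
  by apply Hx; apply Hy.
have HC : H `<=` C by move=> h /(_ _ C1)[]; rewrite mul1g.
have H1 : nbhs 1 H.
  have /compact_near_coveringP := cC.
  move=> /(_ G (nbhs 1) (fun h c => C (c * h) /\ C (c / h)) _); apply=> c Cc.
  have c1 : continuous (fun p : G * G => p.1 * p.2) by exact: mulg_continuous.
  have c2 : continuous (fun p : G * G => p.1 / p.2).
    apply: continuousM; first by move=> p; exact: cvg_fst.
    by apply: continuousV; move=> p; exact: cvg_snd.
  have n1 : nbhs (c, 1 : G) ((fun p : G * G => p.1 * p.2) @^-1` C).
    by apply: preimage_nbhs => //; apply: open_nbhs_nbhs; rewrite /= mulg1.
  have n2 : nbhs (c, 1 : G) ((fun p : G * G => p.1 / p.2) @^-1` C).
    apply: preimage_nbhs => //; apply: open_nbhs_nbhs.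
    by rewrite /= invg1 mulg1.
  exact: filterI n1 n2.
have oH := subgroup_open sH H1.
exists H; split=> //; last exact: subset_trans HC CO.
by apply: subclosed_compact cC HC; exact: subgroup_open_closed.
Qed.

End Compactness.

(** * Finiteness and Baire category *)

Definition normalizer (G : groupType) (H : set G) : set G :=
  [set g | conjset g H = H].

Section Normalizer.
Variable G : groupType.
Implicit Types (H : set G).

Lemma subgroup_normalizer H : subgroup (normalizer H).
Proof.
apply/subgroupP; split=> [|x y Hx Hy]; first exact: conjset1.
by rewrite /normalizer /= conjsetM -{1}Hy conjsetK.
Qed.

Lemma normalizerT H :
  subgroup H -> normalizer H = [set: G] -> normal_subgroup H.
Proof.
move=> sH nH; split=> // x g Hx.
have : normalizer H g by rewrite nH.
by move=> gH; move: Hx; rewrite -{1}gH.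
Qed.

End Normalizer.

Lemma compact_seq_cluster (T : topologicalType) (K : set T) (u : nat -> T) :
  compact K -> (forall n, K (u n)) ->
  exists2 d, K d & forall O m, nbhs d O -> exists2 n, (m <= n)%N & O (u n).
Proof.
move=> cK Ku; have [|d [Kd cd]] := cK (u @ \oo) _.
  by exists 0%N => // n _; exact: Ku.
exists d => // O m Od.
have /cd/(_ Od)[_ [[n mn <-] Oun]] : (u @ \oo) (u @` [set n | (m <= n)%N]).
  by exists m => // n /= mn; exists n.
by exists n.
Qed.

Lemma closed_cluster (T : topologicalType) (u : nat -> T) (d : T) (F : set T) m :
  (forall O m, nbhs d O -> exists2 n, (m <= n)%N & O (u n)) ->
  closed F -> (forall n, (m <= n)%N -> F (u n)) -> F d.
Proof.
move=> cd cF Fu; apply: cF => O /(cd _ m)[n mn Oun].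
by exists (u n); split=> //; exact: Fu.
Qed.

(** * Groups of the class: generation, trivial quasi-center, countable coset covers *)

Section ClassS.
Variable G : topologicalGroupType.
Implicit Types (A B D H K N O P Q R U V W : set G) (x y g h : G).

Lemma discrete_spaceP : nbhs (1 : G) [set 1] -> discrete_space G.
Proof.
move=> n1; apply/funext => x; apply/seteqP; split=> O.
  by move=> Ox; apply/principal_filterP; exact: nbhs_singleton.
move/principal_filterP => Ox; apply: nbhs_mulgl.
by apply: filterS n1 => _ ->; rewrite /= mulg1.
Qed.

(** By density, finitely many cosets dV with d in [D] cover a compact generating set. *)
Lemma finite_dense_generation D V : compactly_generated G ->
  closure D = [set: G] -> nbhs 1 V -> subgroup V ->
  exists2 s : seq G, forall d, d \in s -> D d &
    forall H, subgroup H -> V `<=` H -> (forall d, d \in s -> H d) ->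
      H = [set: G].
Proof.
move=> [K cK Kgen] Dd V1 sV.
have [||s sD Ks] := @compact_seq_cover _ _ K D
    (fun d => [set x | V (d^-1 * x)]) cK.
- by move=> d _; exact/open_mulgl/subgroup_open.
- move=> x Kx; have [d Dd' Vd] := dense_coset x Dd V1.
  by exists d => //=; have := subgroupV sV Vd; rewrite invgM invgK.
exists s => // H sH VH sH'; apply/seteqP; split=> // x _.
have : generated_subgroup K x by rewrite Kgen.
apply: smallest_sub => // k /Ks[d /sH' Hd Vdk].
by rewrite -(mulVKg d k); apply: subgroupM => //; exact: VH.
Qed.

Hypothesis hG : class_S G.
Let T2 := class_S_hausdorff hG.
Let lc := class_S_locally_compact hG.
Let cg := class_S_compactly_generated hG.
Let td := class_S_totally_disconnected hG.
Let ts := class_S_topologically_simple hG.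
Let nd := class_S_nondiscrete hG.

Lemma open_normal_subgroupT N :
  normal_subgroup N -> nbhs 1 N -> N = [set: G].
Proof.
move=> nN N1; have [sN _] := nN; have oN := subgroup_open sN N1.
have [N11|//] := ts nN (subgroup_open_closed sN oN).
by case: nd; apply: discrete_spaceP; rewrite -N11.
Qed.

Lemma normal_subgroup_dense N :
  normal_subgroup N -> N <> [set 1] -> closure N = [set: G].
Proof.
move=> nN N1; have [cN1|//] := ts (normal_closure nN) (@closed_closure _ N).
case: N1; apply/seteqP; split=> [x Nx|_ ->].
  by rewrite -cN1; exact: subset_closure.
by apply: subgroup1; case: nN.
Qed.

Lemma proper_compact_open_subgroup O : nbhs 1 O ->
  exists V, [/\ subgroup V, nbhs 1 V, compact V, V `<=` O & V <> [set: G]].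
Proof.
move=> O1; have [x x1] : exists x : G, x <> 1.
  apply: contrapT => H; apply: nd; apply: discrete_spaceP.
  apply: filterS (nbhs1T G) => x _.
  by apply: contrapT => x1; apply: H; exists x.
have O'1 : nbhs 1 (O `&` ~` [set x]).
  apply: filterI => //; apply: open_nbhs_nbhs; split; last by move=> /esym.
  by apply: closed_openC; apply: accessible_closed_set1; exact: hausdorff_accessible.
have [V [sV oV cV VO]] := compact_open_subgroup T2 lc td O'1.
exists V; split=> //.
- by apply: open_nbhs_nbhs; split=> //; exact: subgroup1.
- by move=> y /VO[].
- move=> VT; have : V x by rewrite VT.
  by move=> /VO[_]; apply.
Qed.

Lemma normal_subgroup_quasi_center : normal_subgroup (@quasi_center G).
Proof.
split.
  apply/subgroupP; split.
    apply: filterS (nbhs1T G) => x _ _ ->; exact: commute1.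
  move=> x y Qx Qy; apply: filterS (filterI Qx Qy) => z [zx zy] _ ->.
  by apply: commuteM; [exact: zx|exact/commuteV/zy].
move=> x g /(nbhs1_conjset g^-1); apply: filterS => y yx _ ->.
by rewrite -(conjgKV g y); apply: commuteJ; apply: yx.
Qed.

(** Otherwise it is dense, and finitely many quasi-central elements generate [G] together with a
    proper compact open [V]. The part of [V] centralizing them is open, and its [V]-core is
    normalized by [V] and by these elements. So the core is open and normal, hence all of [G],
    although it lies in [V]. *)
Lemma quasi_center_trivial : @quasi_center G = [set 1].
Proof.
apply: contrapT => /(normal_subgroup_dense normal_subgroup_quasi_center) qd.
have [V [sV V1 cV _ VT]] := proper_compact_open_subgroup (nbhs1T G).
have [s sq sgen] := finite_dense_generation cg qd V1 sV.
pose W := V `&` centralizer [set` s].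
have W1 : nbhs 1 W.
  apply: filterI => //; elim: s sq {sgen W} => [|d s IHs] sq.
    by apply: filterS (nbhs1T G).
  have qd' : nbhs 1 (centralizer [set d]) by apply: sq; rewrite inE eqxx.
  have sqs : nbhs 1 (centralizer [set` s]).
    by apply: IHs => e es; apply: sq; rewrite inE es orbT.
  apply: filterS (filterI qd' sqs) => x [xd xs] h /=.
  by rewrite inE => /orP[/eqP->|]; [exact: xd|exact: xs].
have sW : subgroup W by apply: subgroupI => //; exact: subgroup_centralizer.
pose C := \bigcap_(v in V) conjset v W.
have CW : C `<=` W by move=> x /(_ 1 (subgroup1 sV)); rewrite /= conjset1.
have C1 : nbhs 1 C by exact: subgroup_core_nbhs.
have sC : subgroup C.
  apply/subgroupP; split=> [v _|x y Cx Cy v Vv].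
    exact: subgroup1 (subgroup_conjset v sW).
  apply: subgroupM (Cx v Vv) _; first exact: subgroup_conjset.
  by apply: subgroupV (Cy v Vv); exact: subgroup_conjset.
apply: VT; apply/seteqP; split=> // x _; suff : C x by move=> /CW[].
suff -> : C = [set: G] by [].
apply: open_normal_subgroupT => //; apply: normalizerT => //.
apply: sgen; first exact: subgroup_normalizer.
- move=> v Vv; apply/seteqP; split=> y Cy w Vw.
    have := Cy (v^-1 * w) (subgroupM sV (subgroupV sV Vv) Vw).
    by rewrite /conjset /= -conjgM mulVKg.
  by have := Cy (v * w) (subgroupM sV Vv Vw); rewrite conjsetM.
- move=> d ds; apply/seteqP; split=> y Cy.
    have [_ /(_ d ds) yd] := CW _ Cy.
    have <- : y ^ d = y by rewrite -{2}(conjgK d y) (conjg_commute (commuteV yd)).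
    by [].
  by rewrite /conjset /= (conjg_commute (y := d)) //; have [_ ] := CW _ Cy; exact.
Qed.

(** Starting from [V], multiply by [K] and its inverses and cover the compact result by finitely
    many cosets of [V], again and again. The union is stable under left multiplication by [K] and
    its inverses, hence is [G]. *)
Lemma sigma_compact V : compact V -> nbhs 1 V -> subgroup V ->
  exists c : nat -> G, forall x, exists i, V ((c i)^-1 * x).
Proof.
move=> cV V1 sV; have [K cK Kgen] := cg.
pose K' := K `|` [set x | K x^-1].
have cK' : compact K' by apply: compactU => //; exact: compact_inv.
pose LV (l : seq G) := [set x | exists2 t, t \in l & V (t^-1 * x)].
have cLV l : compact (LV l).
  elim: l => [|t l IHl].
    have -> : LV [::] = set0 by apply/seteqP; split=> // x [].
    exact: compact0.
  have -> : LV (t :: l) = [set x * y | x in [set t] & y in V] `|` LV l.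
    apply/seteqP; split=> x.
      move=> [u]; rewrite inE => /orP[/eqP-> Vtx|ul Vux]; last by right; exists u.
      by left; exists t => //; exists (t^-1 * x) => //; rewrite mulVKg.
    move=> [[_ -> [y Vy <-]]|[u ul Vux]].
      by exists t; rewrite ?inE ?eqxx// mulKg.
    by exists u => //; rewrite inE ul orbT.
  by apply: compactU => //; apply: compact_mul => //; exact: compact_set1.
have next l : exists l', [set x * y | x in K' & y in LV l] `<=` LV l'.
  have [l' _ Hl'] := compact_cosets (compact_mul cK' (cLV l)) V1 sV.
  by exists l'.
have {next} [next nextP] := choice next.
pose L n := iter n next [:: 1].
pose M := [set x | exists n, LV (L n) x].
have MT : M = [set: G].
  apply/seteqP; split=> // x _.
  pose H := [set g | forall m, M m -> M (g * m) /\ M (g^-1 * m)].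
  have M1 : M 1 by exists 0%N, 1; rewrite ?inE // mulg1 invg1; exact: subgroup1.
  suff : H x by move=> /(_ _ M1)[]; rewrite mulg1.
  have : generated_subgroup K x by rewrite Kgen.
  apply: smallest_sub.
    apply/subgroupP; split=> [m Mm|g h Hg Hh m Mm].
      by rewrite invg1 mul1g.
    rewrite invgM invgK -!mulgA; split.
      by apply Hg; apply Hh.
    by apply Hh; apply Hg.
  move=> k Kk m [n Lnm]; split; exists n.+1; rewrite /L iterS; apply: nextP.
    by exists k; [left|exists m].
  by exists k^-1; [right; rewrite /= invgK|exists m].
exists (fun k => let p := odflt (0%N, 0%N) (unpickle k) in nth 1 (L p.1) p.2).
move=> x; have : M x by rewrite MT.
move=> [n [t tL Vtx]]; exists (pickle (n, index t (L n))).
by rewrite pickleK /= nth_index.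
Qed.

(** If [W] were not a neighbourhood of 1, its cosets would have empty interior. Decreasing non-empty
    compact open sets in [O] avoiding them one after the other would have a common point, lying in
    no coset. *)
Lemma baire_cosets W (d : nat -> G) O : subgroup W -> closed W -> nbhs 1 O ->
  (forall x, O x -> exists k, W ((d k)^-1 * x)) -> nbhs 1 W.
Proof.
move=> sW cW O1 OW; apply: contrapT => W1.
have [K K1 [cK _]] := @lc 1 Logic.I.
have {}K1 : nbhs (1 : G) K.
  by move: K1; rewrite /within /prop_near1 /=; apply: filterS => x; apply.
have nint x k : ~ nbhs x [set y | W ((d k)^-1 * y)].
  move=> nx; apply: W1; have /= Wx := nbhs_singleton nx.
  apply: filterS (nbhs1_mulgl nx) => y /=; rewrite mulgA.
  by move=> Wxy; rewrite -(mulKg ((d k)^-1 * x) y); apply: subgroupM => //;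
    exact: subgroupV.
pose good C := [/\ open C, compact C & exists x, C x].
have step (p : nat * set G) : exists C', good p.2 ->
    [/\ good C', C' `<=` p.2 & forall x, C' x -> ~ W ((d p.1)^-1 * x)].
  have [gC|nC] := pselect (good p.2); last by exists set0.
  case: p gC => k C /= [oC cC [x Cx]].
  have [y [Cy Wy]] : exists y, C y /\ ~ W ((d k)^-1 * y).
    apply: contrapT => H; apply: (nint x k).
    apply: filterS (open_nbhs_nbhs (conj oC Cx)) => y Cy /=.
    by apply: contrapT => Wy; apply: H; exists y.
  have oW' : open [set y | (~` W) ((d k)^-1 * y)].
    exact/open_mulgl/closed_openC.
  have Cy' := open_nbhs_nbhs (conj oC Cy).
  have Wy' := open_nbhs_nbhs (conj oW' Wy).
  have [C' [oC' cC' C'y C'C]] :=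
    compact_open_nbhs T2 td cC Cy' (filterI Cy' Wy').
  exists C' => _; split=> [|z /C'C[]//|z /C'C[]//].
  by split=> //; exists y.
have {step} [next nextP] := choice step.
have [C0 [oC0 cC0 C01 C0O]] := compact_open_nbhs T2 td cK K1 O1.
pose C := fix C n := if n is n'.+1 then next (n', C n') else C0.
have gC n : good (C n).
  elim: n => [|n IHn] /=; first by split=> //; exists 1.
  by have [] := nextP (n, C n) IHn.
have CS n : C n.+1 `<=` C n by have [] := nextP (n, C n) (gC n).
have Cle m n : (m <= n)%N -> C n `<=` C m.
  move=> /subnK <-; elim: (n - m)%N => // j IHj.
  by rewrite addSn; exact: subset_trans (CS _) IHj.
have [u uC] := choice (fun n => let: And3 _ _ e := gC n in e).
have [x C0x clx] := compact_seq_cluster cC0 (fun n => Cle 0%N n (leq0n n) _ (uC n)).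
have Cx n : C n x.
  apply: (closed_cluster (m := n) clx).
    by apply: compact_closed => //; case: (gC n).
  by move=> m nm; apply: (Cle _ _ nm).
have [k Wk] := OW _ (C0O _ C0x).
by have [_ _ /(_ x (Cx k.+1))] := nextP (k, C k) (gC k).
Qed.

(** An open mapping argument: for [V] compact open, the product of the traces of [A] and [B] on [V]
    is a closed subgroup, and countably many of its translates cover [U]. *)
Lemma direct_product_local_product U A B : subgroup U -> open U ->
  closed A -> closed B -> direct_product U A B -> local_product A B.
Proof.
move=> sU oU cA cB [sA sB AB _ UAB] O O1.
have [V [sV oV cV VO]] := compact_open_subgroup T2 lc td O1.
have V1 : nbhs 1 V by apply: open_nbhs_nbhs; split=> //; exact: subgroup1.
have clV : closed V by exact: compact_closed.
pose W := [set a * b | a in A `&` V & b in B `&` V].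
suff : nbhs 1 W.
  apply: filterS => _ [a [Aa Va] [b [Bb Vb]] <-].
  by exists a; [split=> //; exact: VO|exists b => //; split=> //; exact: VO].
have sW : subgroup W.
  apply/subgroupP; split.
    exists 1; first by split; exact: subgroup1.
    by exists 1; [split; exact: subgroup1|rewrite mulg1].
  move=> _ _ [a [Aa Va] [b [Bb Vb]] <-] [a' [Aa' Va'] [b' [Bb' Vb']] <-].
  exists (a / a').
    by split; apply: subgroupM => //; exact: subgroupV.
  exists (b / b').
    by split; apply: subgroupM => //; exact: subgroupV.
  have Bbb' := subgroupM sB Bb (subgroupV sB Bb').
  rewrite invgM; have ba' := commuteV (commute_sym (AB _ _ Aa' Bbb')).
  by rewrite -mulgA -ba' !mulgA.
have cW : closed W.
  apply: compact_closed => //; apply: compact_mul;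
    by rewrite setIC; exact: compact_closedI.
have [c cP] := sigma_compact cV V1 sV.
(* Each coset of [V] that meets [D] gets a representative in [D]; the others get 1. *)
have repr D : D 1 -> exists r : nat -> G, (forall i, D (r i)) /\
    forall x, D x -> exists i, V ((r i)^-1 * x).
  move=> D1; have : forall i, exists y, D y /\
      ((exists2 x, D x & V ((c i)^-1 * x)) -> V ((c i)^-1 * y)).
    move=> i; have [[x Dx Vx]|H] := pselect (exists2 x, D x & V ((c i)^-1 * x)).
      by exists x.
    by exists 1; split=> // /H.
  move=> /choice[r rP]; exists r; split=> [i|x Dx]; first by case: (rP i).
  have [i Vi] := cP x; exists i; have [_ Vr] := rP i.
  have {}Vr : V ((c i)^-1 * r i) by apply: Vr; exists x.
  by have := subgroupM sV (subgroupV sV Vr) Vi; rewrite invgM invgK -mulgA mulVKg.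
have [a [Aa aP]] := repr A (subgroup1 sA).
have [b [Bb bP]] := repr B (subgroup1 sB).
pose d k := let p := odflt (0%N, 0%N) (unpickle k) in a p.1 * b p.2.
have U1 : nbhs 1 U by apply: open_nbhs_nbhs; split=> //; exact: subgroup1.
apply: (@baire_cosets W d U) => // x; rewrite UAB => -[y Ay [z Bz <-]].
have [i Vi] := aP _ Ay; have [j Vj] := bP _ Bz.
exists (pickle (i, j)); rewrite /d pickleK /=.
exists ((a i)^-1 * y).
  by split=> //; apply: subgroupM => //; exact: subgroupV.
exists ((b j)^-1 * z).
  by split=> //; apply: subgroupM => //; exact: subgroupV.
have Aay : A ((a i)^-1 * y) by apply: subgroupM => //; exact: subgroupV.
rewrite invgM !mulgA; congr (_ * z).
rewrite -[RHS]mulgA.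
by rewrite (commuteV (AB _ _ Aay (Bb j))) ?mulgA.
Qed.

End ClassS.

(** * The action on local factors *)

Section Simplicity.
Variable G : topologicalGroupType.
Hypothesis hG : class_S G.
Implicit Types (A B D E F H K M N O P Q R U V W : set G) (x y g h : G).
Implicit Types s t : seq G.
Let T2 := class_S_hausdorff hG.
Let qz := quasi_center_trivial hG.

Lemma local_factor_closed P : local_factor P -> closed P.
Proof. by case=> <- _; exact: closed_centralizer. Qed.

(** Both P and C(P) normalize P, and P C(P) is a neighbourhood of 1. *)
Lemma normalizer_local_factor P : local_factor P -> nbhs 1 (normalizer P).
Proof.
move=> fP; have sP := local_factor_subgroup fP; case: (fP) => _ PxQ.
apply: filterS (PxQ _ (nbhs1T G)) => x xPQ.
suff sub y : [set a * b | a in P `&` setT & b in centralizer P `&` setT] y ->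
    P `<=` conjset y P.
  apply/seteqP; split; last exact: sub.
  have sub' : P `<=` conjset x^-1 P.
    apply: sub; case: xPQ => a [Pa _] [b [Qb _] <-].
    exists a^-1; first by split=> //; exact: subgroupV.
    exists b^-1; first by split=> //; exact: (subgroupV (@subgroup_centralizer _ P)).
    rewrite -invgM; congr _^-1; exact: Qb.
  by move=> z /sub'; rewrite /conjset /= conjgK.
move=> [a [Pa _] [b [Qb _] <-]] z Pz; rewrite /conjset /= conjgM.
rewrite (conjg_commute (y := b)); first exact: subgroupJ.
by apply/commute_sym/Qb; exact: subgroupJ.
Qed.

Lemma trivial_subgroup H : subgroup H -> H `<=` [set 1] -> H = [set 1].
Proof. by move=> sH H1; apply/seteqP; split=> // _ ->; exact: subgroup1. Qed.

Lemma conjset_nontrivial g P : P <> [set 1] -> conjset g P <> [set 1].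
Proof. by move=> P1 /(congr1 (conjset g^-1)); rewrite conjsetK conjset_sub1. Qed.

Lemma nontrivial_elt P : local_factor P -> P <> [set 1] -> exists2 x, P x & x <> 1.
Proof.
move=> fP P1; have [x [Px _ x1]] :=
  local_factor_nontrivial qz fP (nbhs1T G) P1.
by exists x.
Qed.

(** In the Boolean algebra of local factors, this is the complement of the join of finitely many
    conjugates of [P]. *)
Definition conj_centralizer P s : set G :=
  centralizer (\bigcup_(g in [set` s]) conjset g P).

Lemma conj_centralizerP P s x :
  conj_centralizer P s x <-> forall g, g \in s -> centralizer (conjset g P) x.
Proof.
split=> [Hx g gs y Py|Hx y [g /= gs Py]]; last exact: Hx Py.
by apply: Hx; exists g.
Qed.

Lemma conj_centralizer_cons P g s :
  conj_centralizer P (g :: s) = conj_centralizer P s `&` centralizer (conjset g P).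
Proof.
apply/seteqP; split=> x.
  move/conj_centralizerP => Hx; split; last by apply: Hx; rewrite inE eqxx.
  by apply/conj_centralizerP => h hs; apply: Hx; rewrite inE hs orbT.
move=> [/conj_centralizerP Hx gx]; apply/conj_centralizerP => h.
by rewrite inE => /orP[/eqP->|/Hx].
Qed.

Lemma conj_centralizerS P s t : {subset s <= t} ->
  conj_centralizer P t `<=` conj_centralizer P s.
Proof.
by move=> st x /conj_centralizerP Hx; apply/conj_centralizerP => g /st; exact: Hx.
Qed.

Lemma local_factor_conj_centralizer P s :
  local_factor P -> local_factor (conj_centralizer P s).
Proof.
move=> fP; elim: s => [|g s IHs].
  have -> : conj_centralizer P [::] = [set: G].
    by apply/seteqP; split=> // x _; apply/conj_centralizerP.
  exact: local_factor_setT.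
rewrite conj_centralizer_cons; apply: local_factorI => //.
exact/local_factorC/local_factor_conjset.
Qed.

(* The union of the centralisers of all [conj_centralizer P t] is a normal subgroup
   containing [P], hence dense; so finitely many of its elements generate [G]
   together with [V], and they all centralise a single [conj_centralizer P t].  Its
   finitely many [V]-conjugates then meet in a normal subgroup. *)
Lemma conj_centralizer_trivial P : local_factor P -> P <> [set 1] ->
  exists s, conj_centralizer P s = [set 1].
Proof.
move=> fP P1; pose D := [set x | exists s, centralizer (conj_centralizer P s) x].
have nD : normal_subgroup D.
  split; first (apply/subgroupP; split).
  - by exists [::] => y _; exact/commute_sym/commute1.
  - move=> x y [s xs] [t yt]; exists (s ++ t).
    apply: (subgroupM (@subgroup_centralizer _ (conj_centralizer P (s ++ t)))).
      apply: centralizerS xs; apply: conj_centralizerS => g gs.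
      by rewrite mem_cat gs.
    apply: (subgroupV (@subgroup_centralizer _ (conj_centralizer P (s ++ t)))).
    apply: centralizerS yt; apply: conj_centralizerS => g gt.
    by rewrite mem_cat gt orbT.
  move=> x g [s xs]; exists [seq g^-1 * h | h <- s] => y /conj_centralizerP Hy.
  rewrite -(conjgKV g y); apply/commuteJ/xs/conj_centralizerP => h hs.
  have := Hy (g^-1 * h) (map_f _ hs).
  by rewrite conjsetM centralizer_conjset.
have PD : P `<=` D.
  move=> x Px; exists [:: 1] => y /conj_centralizerP/(_ 1).
  rewrite inE eqxx conjset1 => /(_ isT) Hy.
  exact/commute_sym/Hy.
have D1 : D <> [set 1].
  move=> D1; have [x Px] := nontrivial_elt fP P1; apply.
  by have := PD _ Px; rewrite D1.
have [V [sV V1 cV _ VT]] :=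
  proper_compact_open_subgroup hG (nbhs1T G).
have [s sD sgen] := finite_dense_generation (class_S_compactly_generated hG)
  (normal_subgroup_dense hG nD D1) V1 sV.
have [t tC] : exists t, forall d, d \in s -> centralizer (conj_centralizer P t) d.
  elim: s sD {sgen} => [|d s IHs] sD; first by exists [::].
  have [|t tC] := IHs; first by move=> e es; apply: sD; rewrite inE es orbT.
  have [u uC] : D d by apply: sD; rewrite inE eqxx.
  exists (u ++ t) => e; rewrite inE => /orP[/eqP->|/tC].
    by apply: centralizerS uC; apply: conj_centralizerS => g gu; rewrite mem_cat gu.
  by apply: centralizerS; apply: conj_centralizerS => g gt; rewrite mem_cat gt orbT.
pose R := \bigcap_(v in V) conjset v (conj_centralizer P t).
have Rt : R `<=` conj_centralizer P t.
  by move=> x /(_ 1 (subgroup1 sV)); rewrite /= conjset1.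
have sR : subgroup R.
  apply/subgroupP; split=> [v _|x y Rx Ry v Vv].
    exact: subgroup1 (subgroup_conjset v (@subgroup_centralizer _ _)).
  apply: subgroupM (Rx v Vv) _; first exact/subgroup_conjset/subgroup_centralizer.
  by apply: subgroupV (Ry v Vv); exact/subgroup_conjset/subgroup_centralizer.
have cR : closed R.
  by apply: closed_bigI => v _; apply: closed_conjset; exact: closed_centralizer.
have nR : normal_subgroup R.
  apply: normalizerT => //; apply: sgen; first exact: subgroup_normalizer.
  - move=> v Vv; apply/seteqP; split=> y Ry w Vw.
      have := Ry (v^-1 * w) (subgroupM sV (subgroupV sV Vv) Vw).
      by rewrite /conjset /= -conjgM mulVKg.
    by have := Ry (v * w) (subgroupM sV Vv Vw); rewrite conjsetM.
  - move=> d ds; have dR y : R y -> y ^ d = y.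
      by move=> /Rt Hy; apply/conjg_commute/commute_sym/tC.
    apply/seteqP; split=> y Ry; last by rewrite /conjset /= dR.
    by rewrite -(conjgK d y) (conjg_commute (commuteV _)) //; exact/commute_sym/tC/Rt.
have R1 : R = [set 1].
  have [//|RT] := class_S_topologically_simple hG nR cR.
  case: VT; apply: sgen => // d ds; suff -> : d = 1 by exact: subgroup1.
  apply: (qz_eq1 qz (nbhs1T G)) => y _; apply: tC => //.
  by apply: Rt; rewrite RT.
(* The conjugate of [conj_centralizer P t] by [v] depends only on the coset vW, so finitely many [v]
   suffice to define [R]. *)
pose W := [set v | forall g, g \in t -> normalizer (conjset g P) v].
have W1 : nbhs 1 W.
  rewrite /W; elim: (t) => [|g u IHu].
    by apply: filterS (nbhs1T G).
  have := normalizer_local_factor (local_factor_conjset g fP).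
  move=> /filterI/(_ IHu); apply: filterS => v [gv uv] h.
  by rewrite inE => /orP[/eqP->//|/uv].
have sW : subgroup W.
  apply/subgroupP; split=> [g _|x y Wx Wy g gt].
    exact: subgroup1 (@subgroup_normalizer _ _).
  apply: (subgroupM (@subgroup_normalizer _ (conjset g P))); first exact: Wx.
  by apply: (subgroupV (@subgroup_normalizer _ (conjset g P))); exact: Wy.
have [r _ rV] := compact_cosets cV W1 sW.
exists [seq u * g | u <- r, g <- t].
apply: trivial_subgroup; first exact: subgroup_centralizer.
rewrite -R1 => x /conj_centralizerP Hx v /rV[u ur Wuv].
rewrite /conjset /=; apply/conj_centralizerP => g gt.
have : centralizer (conjset (u * g) P) x by apply: Hx; apply/allpairsP; exists (u, g).
have -> : conjset (u * g) P = conjset v (conjset g P).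
  by rewrite -[v in RHS](mulVKg u) [RHS]conjsetM [LHS]conjsetM (Wuv g gt).
by rewrite centralizer_conjset.
Qed.

(** By normality, [N] contains the small elements of every conjugate of [P]. Splitting off one
    conjugate at a time writes a small element as a member of [N] times a member of
    [conj_centralizer P s], which is 1 for a suitable [s]. *)
Lemma normal_subgroupT N P O : normal_subgroup N -> local_factor P ->
  P <> [set 1] -> nbhs 1 O -> P `&` O `<=` N -> N = [set: G].
Proof.
move=> nN fP P1 O1 PON; have [sN _] := nN.
have [s s1] := conj_centralizer_trivial fP P1.
have small V : nbhs 1 V -> exists2 V', nbhs 1 V' & forall x, V' x ->
    exists n r, [/\ N n, conj_centralizer P s r, V r & x = n * r].
  elim: s {s1} V => [|g s IHs] V V1.
    exists V => // x Vx; exists 1, x; split=> //; first exact: subgroup1.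
      exact/conj_centralizerP.
    by rewrite mul1g.
  have O2 : nbhs 1 (V `&` conjset g O) by apply: filterI => //; exact: nbhs1_conjset.
  have [O' O'1 split] := local_factor_split qz (local_factor_conjset g fP)
    (local_factor_conj_centralizer s fP) O2.
  have [V' V'1 V'P] := IHs _ O'1.
  exists V' => // x /V'P[n [r [Nn Rr O'r ->]]].
  have [p [q [[Rp Pp [_ Op]] [[Rq Qq [Vq _]] ->]]]] := split _ Rr O'r.
  exists (n * p), q; split=> //.
  - apply: subgroupM => //; rewrite -(normal_subgroup_conjset nN g).
    by apply: PON; split.
  - by rewrite conj_centralizer_cons.
  - by rewrite mulgA.
have [V' V'1 V'P] := small _ (nbhs1T G).
apply: (open_normal_subgroupT hG) => //; apply: filterS V'1 => x /V'P.
by rewrite s1 => -[n [r [Nn -> _ ->]]]; rewrite mulg1.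
Qed.

Lemma closed_normalizer H : closed H -> closed (normalizer H).
Proof.
move=> cH.
have -> : normalizer H =
    \bigcap_(h in H) ([set x | H (h ^ x)] `&` [set x | H (h ^ x^-1)]).
  apply/seteqP; split=> [x Hx h Hh|x Hx].
    split; first by rewrite -Hx in Hh.
    by rewrite /= -{1}Hx /conjset /= conjgKV.
  apply/seteqP; split=> h Hh; last by have [] := Hx h Hh.
  by have [_] := Hx _ Hh; rewrite /= conjgK.
have cont (f : G -> G) h : continuous f -> continuous (fun x => h ^ f x).
  move=> cf; apply: continuousM; first exact: continuousV.
  by apply: continuousM => //; exact: cst_continuous.
apply: closed_bigI => h _; apply: closedI.
  apply: (preimage_closed (f := fun x => h ^ x)) cH => y _.
  by apply: cont; exact: idg_continuous.
apply: (preimage_closed (f := fun x => h ^ x^-1)) cH => y _.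
by apply: (cont (fun x => x^-1)); exact: invg_continuous.
Qed.

(** * Dynamics on the local factors when one of them is neither trivial nor all of G *)

Section Decomposed.
Variable P0 : set G.
Hypotheses (fP0 : local_factor P0) (P01 : P0 <> [set 1]).
Hypothesis Q01 : centralizer P0 <> [set 1].

Lemma center_trivial : centralizer [set: G] = [set 1].
Proof.
apply: trivial_subgroup; first exact: subgroup_centralizer.
move=> x Cx; apply: (qz_eq1 qz (nbhs1T G)) => y _; exact: Cx.
Qed.

(** The kernel of the action on local factors is closed and normal. Were it [G], then [P0] would be
    a closed normal subgroup, so either [P0] or C(P0) would be trivial. *)
Lemma local_factor_kernel y :
  (forall F, local_factor F -> normalizer F y) -> y = 1.
Proof.
move=> Hy; pose N := \bigcap_(F in @local_factor G) normalizer F.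
have nN : normal_subgroup N.
  split.
    apply/subgroupP; split=> [F fF|x z Nx Nz F fF].
      exact: subgroup1 (@subgroup_normalizer _ _).
    apply: (subgroupM (@subgroup_normalizer _ F)); first exact: Nx.
    by apply: (subgroupV (@subgroup_normalizer _ F)); exact: Nz.
  move=> x g Nx F fF; have := Nx _ (local_factor_conjset g fF).
  by rewrite /normalizer /= conjgE !conjsetM => ->; rewrite conjsetK.
have cN : closed N.
  by apply: closed_bigI => F fF; apply: closed_normalizer; exact: local_factor_closed.
have [N1|NT] := class_S_topologically_simple hG nN cN.
  by rewrite -[_ = 1]/([set 1] y) -N1; exact: Hy.
have nP0 : normal_subgroup P0.
  apply: normalizerT; first exact: local_factor_subgroup.
  apply/seteqP; split=> // x _; have Nx : N x by rewrite NT.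
  exact: Nx.
have [//|P0T] := class_S_topologically_simple hG nP0 (local_factor_closed fP0).
by case: Q01; rewrite P0T center_trivial.
Qed.

(** There are no atoms. Conjugates of an atom are equal or commute, and finitely many have trivial
    common centralizer, so there are finitely many in all. The kernel of the action on them is then
    open and normal, so [M] is normal and equals [G]; this contradicts minimality because of
    [P0]. *)
Lemma local_factor_proper M : local_factor M -> M <> [set 1] ->
  exists M', [/\ local_factor M', M' `<=` M, M' <> [set 1] & M' <> M].
Proof.
move=> fM M1; apply: contrapT => noM.
have atom g F : local_factor F -> F `<=` conjset g M -> F <> [set 1] -> F = conjset g M.
  move=> fF FM F1; apply: contrapT => FneM; apply: noM.
  exists (conjset g^-1 F); split.
  - exact: local_factor_conjset.
  - by move=> x /FM; rewrite /conjset /= conjgKV.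
  - exact: conjset_nontrivial.
  - by move=> FE; apply: FneM; rewrite -FE conjsetVK.
have [s s1] := conj_centralizer_trivial fM M1.
have sM h : exists2 g, g \in s & conjset h M = conjset g M.
  apply: contrapT => H; apply: (@conjset_nontrivial h _ M1).
  apply: trivial_subgroup.
    by apply: subgroup_conjset; exact: local_factor_subgroup.
  rewrite -s1 => x hx; apply/conj_centralizerP => g gs.
  have fh := local_factor_conjset h fM; have fg := local_factor_conjset g fM.
  apply: (local_factor_sub_centralizer qz fh fg) hx.
  have fI := local_factorI qz fh fg.
  have [->//|I1] := pselect (conjset h M `&` conjset g M = [set 1]).
  case: H; exists g => //.
  rewrite -(atom h _ fI _ I1); last exact: subIsetl.
  by rewrite (atom g _ fI _ I1)//; exact: subIsetr.
pose N := [set y | forall h, normalizer (conjset h M) y].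
have nN : normal_subgroup N.
  split.
    apply/subgroupP; split=> [h|x z Nx Nz h].
      exact: subgroup1 (@subgroup_normalizer _ _).
    apply: (subgroupM (@subgroup_normalizer _ (conjset h M))); first exact: Nx.
    by apply: (subgroupV (@subgroup_normalizer _ (conjset h M))); exact: Nz.
  move=> x g Nx h; have := Nx (g * h).
  by rewrite /normalizer /= conjgE !conjsetM => ->; rewrite conjsetK.
have N1 : nbhs 1 N.
  have : nbhs 1 [set y | forall g, g \in s -> normalizer (conjset g M) y].
    elim: (s) => [|g u IHu].
      by apply: filterS (nbhs1T G).
    have := normalizer_local_factor (local_factor_conjset g fM).
    move=> /filterI/(_ IHu); apply: filterS => v [gv uv] h.
    by rewrite inE => /orP[/eqP->//|/uv].
  apply: filterS => y Hy h; have [g gs ->] := sM h; exact: Hy.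
have NT := open_normal_subgroupT hG nN N1.
have nM : normal_subgroup M.
  apply: normalizerT; first exact: local_factor_subgroup.
  apply/seteqP; split=> // x _; have : N x by rewrite NT.
  by move=> /(_ 1); rewrite conjset1.
have [//|MT] := class_S_topologically_simple hG nM (local_factor_closed fM).
have P0M : P0 `<=` conjset 1 M by rewrite MT.
by case: Q01; rewrite (atom _ _ fP0 P0M P01) conjset1 MT center_trivial.
Qed.

(** Some [F] is moved by [x]. If [F] is not inside its conjugate, its part centralizing that
    conjugate is non-trivial and commutes with its own image; otherwise the same applies to
    [x^-1]. *)
Lemma separated_local_factor x : x <> 1 ->
  exists M, [/\ local_factor M, M <> [set 1] & M `<=` centralizer (conjset x M)].
Proof.
move=> x1; have [F fF xF] : exists2 F, local_factor F & ~ normalizer F x.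
  apply: contrapT => H; apply: x1; apply: local_factor_kernel => F fF.
  by apply: contrapT => xF; apply: H; exists F.
have sep y : ~ (F `<=` conjset y F) ->
    exists M, [/\ local_factor M, M <> [set 1] & M `<=` centralizer (conjset y M)].
  move=> FyF; have fyF := local_factor_conjset y fF.
  exists (F `&` centralizer (conjset y F)); split.
  - by apply: local_factorI => //; exact: local_factorC.
  - by move=> M1; apply: FyF; apply: (local_factor_sub qz) => //; rewrite M1.
  - by move=> z [_]; apply: centralizerS; apply: conjsetS; exact: subIsetl.
have [FxF|/sep//] := pselect (F `<=` conjset x F).
have [|M [fM M1 MC]] := sep x^-1.
  move=> FxF'; apply: xF; apply/seteqP; split=> //.
  by move=> z /FxF'; rewrite /conjset /= conjgK.
exists M; split=> //; apply: sub_centralizerC.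
by have := conjsetS (g := x) MC; rewrite -centralizer_conjset conjsetVK.
Qed.

(** An element of [M] centralizing [P] commutes with [y]. As [y] moves [M] into C(M), this element
    lies in both M and C(M), hence is 1. *)
Lemma separated_sub x y M P :
  M `<=` centralizer (conjset x M) -> conjset y M = conjset x M ->
  local_factor M -> local_factor P -> P y -> M `<=` P.
Proof.
move=> MC yM fM fP Py; apply: (local_factor_sub qz) => // z [Mz Cz].
have zy : z ^ y = z by apply/conjg_commute/Cz.
apply: (local_factor_disjoint qz fM) => //.
have : centralizer (conjset y M) z by rewrite yM; exact: MC.
rewrite centralizer_conjset /conjset /=.
by rewrite zy.
Qed.

(* If [V `\` V1] met no conjugate of [P], then [P `&` V] would lie in every
   conjugate of [V], hence in a proper closed normal subgroup. *)
Lemma local_factor_escape V : compact V -> nbhs 1 V -> subgroup V ->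
    V <> [set: G] ->
  exists2 V1, nbhs 1 V1 /\ subgroup V1 &
    forall P, local_factor P -> P <> [set 1] ->
      exists g x, [/\ conjset g P x, V x & ~ V1 x].
Proof.
move=> cV V1 sV VT; have clV : closed V by exact: compact_closed.
have cT := closureT G.
have [s _ sgen] := finite_dense_generation (class_S_compactly_generated hG) cT V1 sV.
pose W := [set x | forall g, g \in s -> conjset g V x /\ conjset g^-1 V x].
have W1 : nbhs 1 W.
  rewrite /W; elim: (s) => [|g u IHu].
    by apply: filterS (nbhs1T G).
  have n1 := nbhs1_conjset g V1; have n2 := nbhs1_conjset g^-1 V1.
  apply: filterS (filterI (filterI n1 n2) IHu) => v [[? ?] uv] h.
  by rewrite inE => /orP[/eqP->//|/uv].
have sW : subgroup W.
  apply/subgroupP; split=> [g _|x y Wx Wy g gs].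
    by split; apply: subgroup1; exact: subgroup_conjset.
  have [? ?] := Wx g gs; have [? ?] := Wy g gs.
  by split; apply: subgroupM => //; try apply: subgroupV => //; exact: subgroup_conjset.
exists W => // P fP P1; apply: contrapT => noP.
have PW g x : conjset g P x -> V x -> W x.
  by move=> ? ?; apply: contrapT => ?; apply: noP; exists g, x.
(* [H] keeps in [V] the elements of [V] lying in conjugates of [P]. It contains [V], and also [s],
   because such elements are assumed to lie in [W]. *)
pose H := [set h | forall g x, conjset g P x -> V x -> V (x ^ h) /\ V (x ^ h^-1)].
have HT : H = [set: G].
  apply: sgen.
  - apply/subgroupP; split=> [g x _ Vx|h k Hh Hk g x Px Vx].
      by rewrite invg1 conjg1.
    rewrite invgM invgK !conjgM; have [V1' V2'] := Hh g x Px Vx.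
    have [V3 V4] := Hk g x Px Vx; split.
      apply (Hk (h^-1 * g)) => //.
      by rewrite conjsetM /conjset /= conjgK.
    apply (Hh (k^-1 * g)) => //.
    by rewrite conjsetM /conjset /= conjgK.
  - move=> v Vv g x _ Vx; split; apply: subgroupJ => //; exact: subgroupV.
  - by move=> g gs h x Px Vx; have [] := PW _ _ Px Vx g gs.
pose N := \bigcap_(h in [set: G]) conjset h V.
have NV : N `<=` V by move=> x /(_ 1 Logic.I); rewrite /= conjset1.
have nN : normal_subgroup N.
  split.
    apply/subgroupP; split=> [h _|x y Nx Ny h _].
      exact: subgroup1 (subgroup_conjset h sV).
    apply: subgroupM; [exact: subgroup_conjset|exact: Nx|].
    by apply: subgroupV; [exact: subgroup_conjset|exact: Ny].
  move=> x g Nx h _; have := Nx (g * h) Logic.I.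
  by rewrite /= conjsetM.
have cN : closed N by apply: closed_bigI => h _; exact: closed_conjset.
have [N1|NT] := class_S_topologically_simple hG nN cN; last first.
  by apply: VT; apply/seteqP; split=> // x _; apply: NV; rewrite NT.
have [p [Pp Vp]] := local_factor_nontrivial qz fP V1 P1; apply.
rewrite -[_ = 1]/([set 1] p) -N1 => h _.
have : H h by rewrite HT.
by move=> /(_ 1 p); rewrite conjset1 => /(_ Pp Vp)[].
Qed.

(** Each point [x] of the compact set of elements of [V] outside [W] moves some [M x] to a commuting
    copy, and all points of x Norm(M x) move it to the same copy; so finitely many factors serve all
    points. Every [P] has a conjugate meeting this set, and [separated_sub] applies. *)
Lemma finite_minorants : exists s (M : G -> set G),
  (forall k, k \in s -> local_factor (M k) /\ M k <> [set 1]) /\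
  forall P, local_factor P -> P <> [set 1] ->
    exists k g, k \in s /\ M k `<=` conjset g P.
Proof.
have [V [sV V1 cV _ VT]] :=
  proper_compact_open_subgroup hG (nbhs1T G).
have [W [W1 sW] escape] := local_factor_escape cV V1 sV VT.
have cVW : compact (V `\` W).
  by apply: compact_closedI => //; apply: open_closedC; exact: subgroup_open.
have ex x : exists M, x <> 1 ->
    [/\ local_factor M, M <> [set 1] & M `<=` centralizer (conjset x M)].
  have [->|x1] := pselect (x = 1); first by exists set0.
  by have [M HM] := separated_local_factor x1; exists M.
have {ex} [M MP] := choice ex.
have VW1 x : (V `\` W) x -> x <> 1.
  by move=> [_ Wx] x1; apply: Wx; rewrite x1; exact: subgroup1.
have [||s sVW sP] := @compact_seq_cover _ _ (V `\` W) (V `\` W)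
  (fun k => [set x | normalizer (M k) (k^-1 * x)]) cVW.
- move=> k /VW1/MP[fM _ _]; apply/open_mulgl/subgroup_open.
    exact: subgroup_normalizer.
  exact: normalizer_local_factor.
- move=> x VWx; exists x => //=; rewrite mulVg.
  exact: subgroup1 (@subgroup_normalizer _ _).
exists s, M; split=> [k /sVW/VW1/MP[]//|P fP P1].
have [g [x [Px Vx Wx]]] := escape _ fP P1.
have [k ks nk] := sP x (conj Vx Wx).
have [fM _ MC] := MP _ (VW1 _ (sVW _ ks)).
exists k, g; split=> //; apply: (separated_sub MC _ fM _ Px).
  by rewrite -{1}(mulVKg k x) conjsetM nk.
exact: local_factor_conjset.
Qed.

(* In the finite family of [finite_minorants] every member properly contains a
   conjugate of another one, so two terms of such a chain coincide. *)
Lemma skewering : exists M g,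
  [/\ local_factor M, M <> [set 1], conjset g M `<=` M & conjset g M <> M].
Proof.
have [s [M [MP minor]]] := finite_minorants.
(* The pair consists of the index of a smaller member and the conjugating element; [(1, 1)] is a
   dummy value outside [s]. *)
have ex k : exists p : G * G, k \in s -> [/\ p.1 \in s,
    conjset p.2 (M p.1) `<=` M k & conjset p.2 (M p.1) <> M k].
  have [ks|ks] := boolP (k \in s); last by exists (1, 1).
  have [fM M1] := MP k ks.
  have [M' [fM' M'M M'1 M'ne]] := local_factor_proper fM M1.
  have [k' [g [k's Mk']]] := minor _ fM' M'1.
  have M'' : conjset g^-1 (M k') `<=` M' by move=> x /Mk'; rewrite /conjset /= conjgKV.
  exists (k', g^-1) => _; split=> //=; first exact: subset_trans M'M.
  move=> E; apply: M'ne; apply/seteqP; split=> // x Mx; apply: M''.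
  by rewrite E.
have {ex} [p pP] := choice ex.
pose f k := (p k).1.
have [k0 [_ [k0s _]]] := minor _ fP0 P01.
have fs n : iter n f k0 \in s.
  by elim: n => //= n IHn; have [] := pP _ IHn.
have chain n m : exists2 g, conjset g (M (iter (n + m.+1) f k0)) `<=` M (iter n f k0)
    & conjset g (M (iter (n + m.+1) f k0)) <> M (iter n f k0).
  elim: m => [|m [g gS gN]].
    by rewrite addn1 /=; have [_ ? ?] := pP _ (fs n); exists (p (iter n f k0)).2.
  have [_] := pP _ (fs (n + m.+1)%N); rewrite -/(f _) -iterS -addnS.
  set h := (p _).2 => hS hN; have hgS := subset_trans (conjsetS (g := g) hS) gS.
  exists (g * h); rewrite conjsetM //.
  move=> E; apply: gN; apply/seteqP; split=> // x.
  by rewrite -E; exact: (conjsetS hS).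
(* Pigeonhole: one more iterate than [s] has entries, all of them in [s]. *)
have : ~~ uniq (traject f k0 (size s).+1).
  apply/negP => /uniq_leq_size -/(_ s).
  rewrite size_traject ltnn => /(_ _)/negP; apply=> //.
  by move=> _ /trajectP[n _ ->].
move=> /(uniqPn k0)[i [j [ij]]]; rewrite size_traject => js.
rewrite !nth_traject //; last exact: ltn_trans js.
move=> eqij; have [fM M1] := MP _ (fs i).
have [g] := chain i (j - i.+1)%N; rewrite addnS -addSn subnKC // -eqij => gS gN.
by exists (M (iter i f k0)), g.
Qed.

End Decomposed.
End Simplicity.

(** * Contraction *)

Section Contraction.
Variable G : topologicalGroupType.
Hypothesis hG : class_S G.
Implicit Types (A B D E F H K M N O Q R U V W : set G) (x y z h : G).
Let T2 := class_S_hausdorff hG.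
Let qz := quasi_center_trivial hG.

Variables (P : set G) (g : G).
Hypotheses (fP : local_factor P) (P1 : P <> [set 1]).
Hypotheses (gS : conjset g P `<=` P) (gN : conjset g P <> P).

Let Pk k := conjset (g ^+ k) P.
Let Ek k := conjset (g ^+ k) (P `&` centralizer (conjset g P)).

Lemma skewer_complement_nontrivial : centralizer P <> [set 1].
Proof.
move=> Q1; apply: gN; case: (local_factor_conjset g fP) => <- _.
rewrite centralizer_conjset Q1 conjset_sub1 centralizer1.
by case: fP => <- _; rewrite Q1 centralizer1.
Qed.

Let PkS i j : (i <= j)%N -> Pk j `<=` Pk i.
Proof.
move=> /subnK <-; elim: (j - i)%N => // m IHm; rewrite addSn.
apply: subset_trans IHm; rewrite /Pk expgSr conjsetM; exact: conjsetS.
Qed.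

Let fPk k : local_factor (Pk k).
Proof. exact: local_factor_conjset. Qed.

Let fEk k : local_factor (Ek k).
Proof.
apply: local_factor_conjset; apply: local_factorI => //.
exact/local_factorC/local_factor_conjset.
Qed.

Let EkP k : Ek k = Pk k `&` centralizer (Pk k.+1).
Proof. by rewrite /Ek conjsetI -centralizer_conjset -conjsetM -expgSr. Qed.

Let Ek1 k : Ek k <> [set 1].
Proof.
apply: conjset_nontrivial => E1; apply: gN; apply/seteqP; split=> //.
apply: (local_factor_sub qz) => //; first exact: local_factor_conjset.
by rewrite E1.
Qed.

(** Put M = F n C(y F y^-1): only 1 in M commutes with y. So M meets C(P) trivially and lies in P;
    meeting every E_k trivially, it lies in every P_k by induction. Then y centralizes M, so M = 1
    and F lies in y F y^-1. The same for y^-1 shows that y normalizes every F. *)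
Lemma skewer_centralizer y :
  centralizer (centralizer P) y -> (forall k, centralizer (Ek k) y) ->
  (forall F, local_factor F -> (forall k, F `<=` Pk k) -> centralizer F y) -> y = 1.
Proof.
have sub x F : local_factor F -> centralizer (centralizer P) x ->
    (forall k, centralizer (Ek k) x) ->
    (forall F, local_factor F -> (forall k, F `<=` Pk k) -> centralizer F x) ->
    F `<=` conjset x F.
  move=> fF xQ xE xF; have fxF := local_factor_conjset x fF.
  apply: (local_factor_sub qz) => //.
  have fM := local_factorI qz fF (local_factorC fxF).
  set M := F `&` _ in fM *.
  have fix1 z : M z -> commute x z -> z = 1.
    move=> [Fz Cz] xz; apply: (local_factor_disjoint qz fxF) => //.
    by rewrite /conjset /= (conjg_commute (commute_sym xz)).
  have MP k : M `<=` Pk k.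
    elim: k => [|k IHk].
      rewrite /Pk expg0 conjset1; apply: (local_factor_sub qz) => // z [Mz Qz].
      by apply: fix1 => //; exact: xQ.
    apply: (local_factor_sub qz) => // z [Mz Cz]; apply: fix1 => //.
    by apply: (xE k); rewrite EkP; split=> //; exact: IHk.
  by move=> z Mz; apply: fix1 => //; exact: xF fM MP _ Mz.
move=> yQ yE yF; apply: (local_factor_kernel hG fP P1 skewer_complement_nontrivial).
move=> F fF; apply/seteqP; split; last exact: sub.
have : F `<=` conjset y^-1 F.
  apply: sub => // [|k|F' fF' FP].
  - by apply: (subgroupV (@subgroup_centralizer _ (centralizer P))).
  - by apply: (subgroupV (@subgroup_centralizer _ (Ek k))).
  - by apply: (subgroupV (@subgroup_centralizer _ F')); exact: yF.
by move=> FyF z /FyF; rewrite /conjset /= conjgK.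
Qed.

Lemma skewer_shrinks V V1 : compact V -> nbhs 1 V1 ->
  exists m, forall j, (m <= j)%N -> Ek j `&` V `<=` V1.
Proof.
move=> cV V11; apply: contrapT => noM.
have ex m : exists x, exists2 j, (m <= j)%N & [/\ Ek j x, V x & ~ V1 x].
  apply: contrapT => H; apply: noM; exists m => j mj x [Ex Vx].
  by apply: contrapT => V1x; apply: H; exists x, j.
have [u uP] := choice ex.
have Vu n : V (u n) by have [j _ []] := uP n.
have [d Vd cd] := compact_seq_cluster cV Vu.
have Pu n : exists2 j, (n <= j)%N & Pk j (u n) /\ centralizer (Pk j.+1) (u n).
  by have [j nj [+ _ _]] := uP n; rewrite EkP => -[? ?]; exists j.
suff d1 : d = 1.
  rewrite -d1 in V11; have [n _ V1u] := cd _ 0%N V11.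
  by have [j _ [_ _]] := uP n.
apply: skewer_centralizer => [|k|F fF FP].
- apply: (closed_cluster (m := 0) cd); first exact: closed_centralizer.
  move=> n _; have [j _ [Pj _]] := Pu n; apply: sub_centralizer2.
  by have := PkS (leq0n j) Pj; rewrite /Pk expg0 conjset1.
(* Terms from index [k.+1] on lie in [Pk k.+1], which centralizes [Ek k]. *)
- apply: (closed_cluster (m := k.+1) cd); first exact: closed_centralizer.
  move=> n kn; have [j nj [Pj _]] := Pu n.
  have : Pk k.+1 (u n) by apply: PkS Pj; exact: leq_trans nj.
  by apply: sub_centralizerC; rewrite EkP; exact: subIsetr.
- apply: (closed_cluster (m := 0) cd); first exact: closed_centralizer.
  by move=> n _; have [j _ [_]] := Pu n; apply: centralizerS; exact: FP.
Qed.

(* With [b_k] the conjugate of [b] by [g ^ k], which tends to [1], any cluster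
   point [x] of the products [b_0 ... b_k] satisfies [b = x g x^-1 g^-1]. *)
Lemma skewer_commutator V : compact V -> subgroup V -> nbhs 1 V ->
  exists m, forall b, Ek m b -> V b -> exists x, b = x * x^-1 ^ g^-1.
Proof.
move=> cV sV V1.
(* With this neighbourhood, [bk k] in [V] forces its conjugate [bk k.+1] into [V], so the whole
   sequence stays in [V]. *)
have V2 : nbhs 1 (conjset g^-1 V) by exact: nbhs1_conjset.
have [m mP] := skewer_shrinks cV V2.
exists m => b Eb Vb; pose bk k := b ^ (g ^+ k)^-1.
have bkS k : bk k.+1 = bk k ^ g^-1 by rewrite /bk expgS invgM conjgM.
have Ebk k : Ek (k + m) (bk k).
  by rewrite /Ek expgnDr conjsetM /bk /conjset /= conjgKV.
have Vbk k : V (bk k).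
  elim: k => [|k IHk]; first by rewrite /bk expg0 invg1 conjg1.
  by rewrite bkS; apply: (mP (k + m)%N _ _ (conj (Ebk k) IHk)); exact: leq_addl.
pose xk := fix xk k := if k is k'.+1 then xk k' * bk k' else 1.
have Vxk k : V (xk k).
  by elim: k => [|k IHk]; [exact: subgroup1|exact: subgroupM].
have xkS k : b * xk k ^ g^-1 = xk k.+1.
  elim: k => [|k IHk].
    by rewrite /= conj1g mulg1 mul1g /bk expg0 invg1 conjg1.
  by rewrite -[RHS]/(xk k.+1 * bk k.+1) -[X in _ = X * _]IHk bkS -mulgA -conjMg.
have [x Vx cx] := compact_seq_cluster cV Vxk.
(* [phi y = 1] is the desired equation for [y]. Since [phi] maps the partial product [xk k] to
   [bk k], which tends to 1, it maps the cluster point to 1. *)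
exists x; pose phi y := y^-1 * (b * y ^ g^-1).
have cphi : continuous phi.
  apply: continuousM; first exact/continuousV/idg_continuous.
  apply: continuousM; first exact: cst_continuous.
  exact: conjg_continuous.
have phik k : phi (xk k) = bk k by rewrite /phi xkS /= mulKg.
have phi1 : phi x = 1.
  apply: contrapT => phix.
  have O1 : nbhs 1 (~` [set phi x]).
    apply: open_nbhs_nbhs; split; last by move=> /esym.
    by apply: closed_openC; apply: accessible_closed_set1; exact: hausdorff_accessible.
  have [W [sW oW _ WO]] := compact_open_subgroup T2
    (class_S_locally_compact hG) (class_S_totally_disconnected hG) O1.
  have W1 : nbhs 1 W by apply: open_nbhs_nbhs; split=> //; exact: subgroup1.
  have [l lP] := skewer_shrinks cV W1.
  suff : W (phi x) by move=> /WO; apply.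
  apply: (closed_cluster (m := l) (F := phi @^-1` W) cx).
    apply: preimage_closed => [y _|]; first exact: cphi.
    exact: subgroup_open_closed.
  move=> n ln; rewrite /= phik; apply: (lP (n + m)%N); last by split.
  exact: leq_trans ln (leq_addr _ _).
move: phi1; rewrite /phi => /mulg1_eq; rewrite invgK => xE.
by rewrite {1}xE conjVg mulgK.
Qed.

Lemma normal_skewerT N : normal_subgroup N -> N g -> N = [set: G].
Proof.
move=> nN Ng; have [sN nNJ] := nN.
have [V [sV V1 cV _ _]] :=
  proper_compact_open_subgroup hG (nbhs1T G).
have [m mP] := skewer_commutator cV sV V1.
apply: (normal_subgroupT hG nN (fEk m) (@Ek1 m) V1) => b [Eb Vb].
have [x ->] := mP b Eb Vb.
(* The commutator is the conjugate x g x^-1 of [g] times [g^-1]. *)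
rewrite conjgE invgK !mulgA; apply: subgroupM => //; last exact: subgroupV.
by have := nNJ _ x^-1 Ng; rewrite conjgE invgK mulgA.
Qed.

End Contraction.

Theorem theorem10 (G : topologicalGroupType) (hG : class_S G)
  (hdec : exists U A B : set G,
      [/\ subgroup U, open U,
          closed A /\ A <> [set 1],
          closed B /\ B <> [set 1]
        & direct_product U A B]) :
  abstractly_simple G.
Proof.
have [U [A [B [sU oU [cA A1] [cB B1] UAB]]]] := hdec.
have AxB := direct_product_local_product hG sU oU cA cB UAB.
have [sA sB AB _ _] := UAB.
have AC : A `<=` centralizer B by move=> a Aa b; exact: AB.
(* [A] is enlarged to C(B), which is its own bicentralizer. *)
have fP : local_factor (centralizer B).
  split; first exact: centralizer3.
  by apply: local_productS AxB => //; exact: sub_centralizer2.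
have P1 : centralizer B <> [set 1].
  by move=> P1; apply: A1; apply: trivial_subgroup => //; rewrite -P1.
have Q1 : centralizer (centralizer B) <> [set 1].
  move=> Q1; apply: B1; apply: trivial_subgroup => //.
  by rewrite -Q1; exact: sub_centralizer2.
have [M [g [fM M1 gM gne]]] := skewering hG fP P1 Q1.
move=> N nN; have [->|N1] := pselect (N = [set 1]); [by left|right].
(* The coset of [g] modulo the open normalizer of [M] meets the dense subgroup [N], and all its
   elements conjugate [M] as [g] does. *)
have [n Nn Mn] := dense_coset g (normal_subgroup_dense hG nN N1)
  (normalizer_local_factor fM).
have nME : conjset n M = conjset g M by rewrite -(mulVKg g n) conjsetM Mn.
by apply: (normal_skewerT hG fM M1 (g := n)) => //; rewrite nME.
Qed.
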